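(* Fix $p>1$, $\beta\in\{1,2\}$, $\alpha\in(0,2\pi)$, $r_0>0$, $N\in\mathbb N$ and $T\in(N\alpha,(N+1)\alpha)$. Let $x(t)=(r(t),\theta(t))$ be the solution of the deterministic impulsive system and, for $\varepsilon\in(0,1)$, let $X^\varepsilon_t=(R^\varepsilon_t,\Theta^\varepsilon_t)$ be the solution of the randomly perturbed impulsive system (without angular drift perturbation and with angular noise $\varepsilon^p\,dB_t$), both as defined in the context. Then there is a constant $C>0$, not depending on $\varepsilon$, such that for all sufficiently small $\varepsilon\in(0,1)$, $$\mathbb E\left[d_{[0,T]}(X^\varepsilon,x)^\beta\right]\le C\,\varepsilon^\beta ,$$ where $d_{[0,T]}$ is the Skorohod metric on $D([0,T];\mathbb R^2)$ defined in the context.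
   Context: Notation: for a function $y$ with one-sided limits, $y^+(t)=\lim_{s\searrow t}y(s)$ for $t\ge0$, $y^-(t)=\lim_{s\nearrow t}y(s)$ for $t>0$, $y^-(0)=y(0)$; for processes these are defined pathwise. Assumptions on the data. $b:\mathbb R\to\mathbb R$ is smooth and bounded with bounded first and second derivatives. The resetting function $h:[0,\infty)\to[0,\infty)$ is strictly increasing, differentiable, satisfies $h(0)=0$, and has continuous bounded derivatives. Deterministic system (in polar coordinates; impacts on $\{\theta=\alpha\}$ reset $(r,\alpha)$ to $(h(r),0)$; initial condition $(r_0,0)$). With $t_k=k\alpha$ for $k\ge0$, $(r(t),\theta(t))$ is the right-continuous function with left limits such that for $t\in[t_{k-1},t_k)$, $k\ge1$, $$r(t)=r^+(t_{k-1})+\int_{t_{k-1}}^t b(r(s))\,ds,\qquad \theta(t)=t-t_{k-1},$$ with $r^+(t_0)=r_0$ and $r^+(t_k)=h(r^-(t_k))$ for $k\ge1$. Stochastic system. $W,B$ are independent standard one-dimensional Brownian motions on a probability space $(\Omega,\mathscr F,\mathbb P)$. $(R^\varepsilon_t,\Theta^\varepsilon_t)$ is the process with right-continuous paths with left limits such that for $t\in[\tau^\varepsilon_{k-1},\tau^\varepsilon_k)$, $k\ge1$, $$R^\varepsilon_t=R^{\varepsilon,+}_{\tau^\varepsilon_{k-1}}+\int_{\tau^\varepsilon_{k-1}}^t b(R^\varepsilon_s)\,ds+\varepsilon(W_t-W_{\tau^\varepsilon_{k-1}}),\qquad \Theta^\varepsilon_t=(t-\tau^\varepsilon_{k-1})+\varepsilon^p(B_t-B_{\tau^\varepsilon_{k-1}}),$$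 where $\tau^\varepsilon_0=0$, $\tau^\varepsilon_k=\inf\{t>\tau^\varepsilon_{k-1}:\Theta^{\varepsilon,-}_t=\alpha\}$ for $k\ge1$, $R^{\varepsilon,+}_{\tau^\varepsilon_0}=r_0$, and $R^{\varepsilon,+}_{\tau^\varepsilon_k}=h(R^{\varepsilon,-}_{\tau^\varepsilon_k})$ for $k\ge1$. Skorohod metric. $D([0,T];\mathbb R^2)$ is the set of right-continuous functions $[0,T]\to\mathbb R^2$ with left limits. Let $\Lambda_T$ be the set of strictly increasing continuous bijections $\lambda$ of $[0,T]$ with $\gamma_T(\lambda):=\sup_{0\le s<t\le T}\left|\log\frac{\lambda(t)-\lambda(s)}{t-s}\right|<\infty$. Then $$d_{[0,T]}(x_1,x_2)=\inf_{\lambda\in\Lambda_T}\left\{\gamma_T(\lambda)\vee\sup_{0\le t\le T}|x_1(t)-x_2(\lambda(t))|\right\}.$$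
   Formalization: The resetting function h is given only on [0,∞), but the noisy radius is negative at an impact with positive probability, so h(R^-) is undefined there; the theorem takes h on all of ℝ, with the stated properties on [0,∞) and Lipschitz on ℝ (any Lipschitz extension). *)

(* Defs.v *)
From HB Require Import structures.
From mathcomp Require Import all_boot all_order all_algebra.
From mathcomp Require Import all_classical all_reals all_analysis.

Set Implicit Arguments.
Unset Strict Implicit.
Unset Printing Implicit Defensive.

Import Order.TTheory GRing.Theory Num.Theory.
Import numFieldNormedType.Exports.

Local Open Scope classical_set_scope.
Local Open Scope ring_scope.

(* Functions of time on [0, +oo[ (or on [0, T]) are encoded as total functions
   on R; only their values at nonnegative times (or on [0, T]) are ever used. *)

Section Paths.
Context {R : realType}.
Implicit Types (y : R -> R) (t : R).

Definition rlim y t : R := lim (y s @[s --> t^'+]).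

Definition llim y t : R := if t == 0 then y 0 else lim (y s @[s --> t^'-]).

Definition cadlag y : Prop :=
  (forall t, 0 <= t -> y s @[s --> t^'+] --> y t) /\
  (forall t, 0 < t -> cvg (y s @[s --> t^'-])).

End Paths.

Section Data.
Context {R : realType}.

Definition smooth (f : R -> R) : Prop :=
  forall n x, derivable (f^`(n)%classic) x 1.

Definition drift (b : R -> R) : Prop :=
  [/\ smooth b, bounded_fun b, bounded_fun (b^`()%classic)
    & bounded_fun (b^`(2)%classic)].

(* Only the restriction of [h] to [0, +oo[ is constrained. The derivative is
   relative to [0, +oo[, hence one-sided at 0. *)
Definition resetting (h : R -> R) : Prop :=
  [/\ (forall x, 0 <= x -> 0 <= h x),
      (forall x y, 0 <= x -> x < y -> h x < h y),
      h 0 = 0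
    & exists dh : R -> R,
      [/\ (forall x, 0 <= x ->
             (h y - h x) / (y - x) @[y --> within (fun y => 0 <= y) x^'] --> dh x),
          {within `[0, +oo[, continuous dh}
        & [bounded dh x | x in `[0, +oo[ ] ] ].

End Data.

Section Systems.
Context {R : realType}.
Local Notation mu := (@lebesgue_measure R).

Definition deterministic_solution (b h : R -> R) (alpha r0 : R)
    (r theta : R -> R) : Prop :=
  [/\ cadlag r, cadlag theta,
      rlim r 0 = r0,
      (forall k, rlim r (k.+1%:R * alpha) = h (llim r (k.+1%:R * alpha)))
    & forall k t, k%:R * alpha <= t < k.+1%:R * alpha ->
        r t = rlim r (k%:R * alpha)
              + \int[mu]_(s in `[k%:R * alpha, t]) b (r s) /\
        theta t = t - k%:R * alpha].

(* Extended-real valued, so that the k-th time is +oo when the level alpha is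
   reached fewer than k times. *)
Fixpoint impact_time (alpha : R) (theta : R -> R) (k : nat) : \bar R :=
  if k is k'.+1 then
    ereal_inf [set t%:E | t in
      [set t : R | (impact_time alpha theta k' < t%:E)%E /\
                   llim theta t = alpha]]
  else 0%E.

(* [x] and [theta] are a path of the perturbed system driven by the noise paths
   [w] (radial) and [v] (angular).  That the intervals between impacts cover
   [0, +oo[ has to be required: a path stopped at theta = alpha has all its
   later impact times equal, so that the equations would say nothing on what
   follows. *)
Definition perturbed_solution (b h : R -> R) (alpha r0 p eps : R)
    (w v : R -> R) (x theta : R -> R) : Prop :=
  let tau := impact_time alpha theta in
  let sigma k := fine (tau k) in
  [/\ cadlag x /\ cadlag theta,
      (forall t, 0 <= t -> exists k, (tau k <= t%:E < tau k.+1)%E),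
      rlim x 0 = r0,
      (forall k, (tau k.+1 < +oo)%E ->
         rlim x (sigma k.+1) = h (llim x (sigma k.+1)))
    & forall k t, (tau k <= t%:E < tau k.+1)%E ->
        x t = rlim x (sigma k) + \int[mu]_(s in `[sigma k, t]) b (x s)
              + eps * (w t - w (sigma k)) /\
        theta t = (t - sigma k) + eps `^ p * (v t - v (sigma k))].

End Systems.

Section Brownian.
Context {R : realType} {d : measure_display} {Omega : measurableType d}
  (P : probability Omega R).

(* The product rule for subfamilies is the case where some [U i] are [setT]. *)
Definition mutually_independent (n : nat) (X : 'I_n -> Omega -> R) : Prop :=
  forall U : 'I_n -> set R, (forall i, measurable (U i)) ->
    P [set omega | forall i, U i (X i omega)] =
    (\prod_(i < n) P (X i @^-1` U i))%E.

Definition brownian_motion (W : R -> {RV P >-> R}) : Prop :=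
  [/\ {ae P, forall omega, W 0 omega = 0},
      (forall (n : nat) (t : nat -> R), 0 <= t 0%N ->
         {homo t : i j / (i <= j)%N >-> i <= j} ->
         mutually_independent
           (fun (i : 'I_n) omega => W (t i.+1) omega - W (t i) omega)),
      (forall s t, 0 <= s -> s < t -> forall U : set R, measurable U ->
         pushforward P (W t \- W s) U = normal_prob 0 (Num.sqrt (t - s)) U)
    & {ae P, forall omega, {within `[0, +oo[, continuous (W ^~ omega)}}].

Definition generated_sigma_algebra (X : R -> {RV P >-> R}) :
    set (set Omega) :=
  <<s [set A | exists t, 0 <= t /\
               exists2 U : set R, measurable U & A = X t @^-1` U] >>.

Definition independent_processes (X Y : R -> {RV P >-> R}) : Prop :=
  forall A B, generated_sigma_algebra X A -> generated_sigma_algebra Y B ->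
    P (A `&` B) = (P A * P B)%E.

End Brownian.

Section Skorohod.
Context {R : realType}.
Implicit Types (T : R) (lam : R -> R) (x y : R -> R * R).

Definition euclidean_norm (u : R * R) : R := Num.sqrt (u.1 ^+ 2 + u.2 ^+ 2).

Definition gamma_T T lam : \bar R :=
  ereal_sup [set `|ln ((lam st.2 - lam st.1) / (st.2 - st.1))|%:E | st in
    [set st : R * R | [/\ 0 <= st.1, st.1 < st.2 & st.2 <= T]]].

Definition time_change T : set (R -> R) :=
  [set lam | [/\ set_bij `[0, T] `[0, T] lam,
                 (forall s t, 0 <= s -> s < t -> t <= T -> lam s < lam t),
                 {within `[0, T], continuous lam}
               & (gamma_T T lam < +oo)%E]].

Definition skorohod T x y : \bar R :=
  ereal_inf [set maxe (gamma_T T lam)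
      (ereal_sup [set (euclidean_norm (x t - y (lam t)))%:E | t in `[0, T]])
    | lam in time_change T].

End Skorohod.

(* Main.v *)
Require Import Defs.
From HB Require Import structures.
From mathcomp Require Import all_boot all_order all_algebra.
From mathcomp Require Import all_classical all_reals all_analysis.
From mathcomp Require Import measurable_realfun ring lra.


(** The estimate holds path by path. For almost every outcome and every [eps] in
    (0, 1), the Skorohod distance is at most [C * eps * expR (c * (mw + mv))],
    where [mw] and [mv] bound the two Brownian paths on [[0, T]] and the
    constants [C] and [c] depend on neither [eps] nor the outcome
    ([pathwise_skorohod_bound]). The maximum of a Brownian path has exponential
    moments of every order ([brownian_maximum_exp_moment]), so taking the power
    [beta] and integrating gives the theorem.

    The pathwise bound rests on one identity: summing the angular equations over
    the first [k] impacts gives [s k + eps `^ p * v (s k) = k%:R * alpha] for the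
    time [s k] of the impact of index [k] ([angle_at_impact]). The impact times
    thus move by at most [eta = eps `^ p * mv], which is at most [eps * mv].

    If [eta] is small compared with the distance from [T] to the multiples of
    [alpha], both systems have exactly [N] impacts on [[0, T]]. The piecewise
    linear time change that matches their impact times has slopes within
    a multiple of [eta] of 1 ([piecewise_linear_time_change]). Between impacts
    Gronwall's lemma compares the radial equations ([compare_solutions]), and
    the Lipschitz resetting function carries the error over an impact
    ([impulsive_path_compare]); after [N] impacts it is still of order [eps].

    If [eta] is not small, the perturbed system may have many impacts, but at
    most [(T + mv) / alpha] of them. The radius grows at most geometrically with
    their number ([impulsive_path_growth]), so both paths are bounded by an
    exponential in [mw + mv], and the missing factor [eps] comes from [eta]
    being bounded below.

    The exponential moments are obtained by chaining over dyadic times: the path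
    is bounded by weighted dyadic increments, each of them Gaussian, and the
    resulting countable sum of exponentials is integrable
    ([dyadic_chaining], [chain_majorantP]). *)

Set Implicit Arguments.
Unset Strict Implicit.
Unset Printing Implicit Defensive.

Import Order.TTheory GRing.Theory Num.Theory.
Import numFieldNormedType.Exports.

Local Open Scope classical_set_scope.
Local Open Scope ring_scope.

(** * Integrals of nonnegative functions *)

Section Integrals.
Local Open Scope ereal_scope.
Context {R : realType} {d : measure_display} {T : measurableType d}.
Implicit Types (mu : {measure set T -> \bar R}) (f g : T -> \bar R).
Import HBNNSimple.

Lemma ge0_integral_le_sup mu f (c : \bar R) : (forall x, 0 <= f x) ->
  (forall h : {nnsfun T >-> R}, (forall x, (h x)%:E <= f x) ->
     \int[mu]_x (h x)%:E <= c) ->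
  \int[mu]_x f x <= c.
Proof.
move=> f0 hc; rewrite ge0_integralTE//; apply: ge_ereal_sup => _ [h /= hf <-].
by rewrite -integralT_nnsfun; exact: hc.
Qed.

(** Only the upper function is assumed measurable: the integral of a
    nonnegative function is a supremum over the simple functions below it. The
    Skorohod distance, an infimum over uncountably many time changes, is
    integrated through this lemma. *)
Lemma ge0_ae_le_integral_outer mu f g :
  (forall x, 0 <= f x) -> (forall x, 0 <= g x) -> measurable_fun [set: T] g ->
  {ae mu, forall x, f x <= g x} -> \int[mu]_x f x <= \int[mu]_x g x.
Proof.
move=> f0 g0 mg fg; apply: ge0_integral_le_sup => // h hf.
apply: ae_ge0_le_integral => //.
- by move=> x _; rewrite lee_fin.
- exact/measurable_EFinP/measurable_funP.
- by apply: filterS fg => x fgx _; exact: le_trans (hf x) fgx.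
Qed.

(** Enough to bound a moment of a law by an integral against its density:
    for a simple function the two sides agree, and a simple function below [f]
    stays below it after multiplication by [q]. *)
Lemma ge0_integral_density mu (nu : {measure set T -> \bar R}) (q : T -> R) f :
  (forall x, (0 <= q x)%R) -> measurable_fun [set: T] q ->
  (forall A, measurable A -> nu A = \int[mu]_(x in A) (q x)%:E) ->
  (forall x, 0 <= f x) -> measurable_fun [set: T] f ->
  \int[nu]_x f x <= \int[mu]_x (f x * (q x)%:E).
Proof.
move=> q0 mq nuE f0 mf; apply: ge0_integral_le_sup => // h hf.
rewrite integralT_nnsfun sintegralE.
apply: (@le_trans _ _ (\int[mu]_x ((h x)%:E * (q x)%:E))); last first.
  apply: ge0_le_integral => //.
  - by move=> x _; rewrite mule_ge0 ?lee_fin.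
  - by apply: emeasurable_funM; apply/measurable_EFinP => //; exact: measurable_funP.
  - by apply: emeasurable_funM => //; apply/measurable_EFinP.
  - by move=> x _; rewrite lee_pmul ?lee_fin.
under [leRHS]eq_integral => x _.
  rewrite fimfunE -fsumEFin// ge0_mule_fsuml; last first.
    by move=> r; rewrite nnfun_muleindic_ge0.
  over.
rewrite ge0_integral_fsum//; last 2 first.
- move=> r; apply: emeasurable_funM; apply/measurable_EFinP => //.
  by apply: measurable_funM => //; exact: measurable_indic.
- by move=> r x _; rewrite mule_ge0 ?lee_fin//; exact: nnfun_muleindic_ge0.
rewrite le_eqVlt; apply/orP; left; apply/eqP; apply: eq_fsbigr => r.
rewrite inE => -[y _ <-].
rewrite nuE// integral_mkcond -ge0_integralZl//; last 3 first.
- apply/(measurable_restrictT _ _).1 => //; apply: measurable_funTS.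
  exact/measurable_EFinP.
- by move=> x _; apply: erestrict_ge0 => z _; rewrite lee_fin.
- by rewrite lee_fin.
apply: eq_integral => x _; rewrite patchE EFinM -muleA; congr (_ * _).
rewrite indicE; case: ifP => _; by rewrite ?mul1e ?mul0e.
Qed.

End Integrals.

(** * Exponential moments of Gaussian variables *)

Section Gaussian.
Context {R : realType}.
Local Notation mu := (@lebesgue_measure R).

(** Completing the square: an exponential weight only shifts the mean of a
    Gaussian density, up to a constant. *)
Lemma expR_tilt_normal_pdf (c s x : R) : s != 0 ->
  expR (c * x) * normal_pdf 0 s x
  = expR (c ^+ 2 * s ^+ 2 / 2) * normal_pdf (c * s ^+ 2) s x.
Proof.
move=> s0; rewrite !normal_pdfE// /normal_fun !subr0.
move: (expf_neq0 2 s0); move: (s ^+ 2) (normal_peak s) => D k D0.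
rewrite mulrCA [RHS]mulrCA -!expRD; congr (k * expR _).
by rewrite -[D *+ 2]mulr_natl; field.
Qed.

Lemma integral_expR_abs_normal_pdf (c s : R) : s != 0 ->
  (\int[mu]_x ((expR (c * `|x|))%:E * (normal_pdf 0 s x)%:E)
   <= (2 * expR (c ^+ 2 * s ^+ 2 / 2))%:E)%E.
Proof.
move=> s0.
have mE (a : R) : measurable_fun [set: R] (fun x => a * x).
  by apply: measurable_funM.
have mexp (a : R) : measurable_fun [set: R] (fun x => expR (a * x)).
  by apply: measurableT_comp.
have mpdf m : measurable_fun [set: R] (fun x => (normal_pdf m s x)%:E).
  by apply/measurable_EFinP; exact: measurable_normal_pdf.
pose K := expR (c ^+ 2 * s ^+ 2 / 2).
have K0 : 0 <= K by exact: expR_ge0.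
have mK m : measurable_fun [set: R] (fun x => (K%:E * (normal_pdf m s x)%:E)%E).
  by apply: emeasurable_funM; [exact: measurable_cst|exact: mpdf].
have pdf0 m x : (0 <= (normal_pdf m s x)%:E)%E by rewrite lee_fin normal_pdf_ge0.
apply: (@le_trans _ _ (\int[mu]_x (K%:E * (normal_pdf (c * s ^+ 2) s x)%:E +
   K%:E * (normal_pdf (- c * s ^+ 2) s x)%:E))%E).
  apply: ge0_le_integral => //=.
  - by move=> x _; rewrite -EFinM lee_fin mulr_ge0 ?expR_ge0// normal_pdf_ge0.
  - apply: emeasurable_funM; apply/measurable_EFinP.
      by apply: measurableT_comp => //; apply: measurable_funM => //;
        exact: measurableT_comp.
    exact: measurable_normal_pdf.
  - by apply: emeasurable_funD; exact: mK.
  - move=> x _; rewrite -!EFinM -EFinD lee_fin.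
    have -> : K * normal_pdf (c * s ^+ 2) s x = expR (c * x) * normal_pdf 0 s x.
      by rewrite expR_tilt_normal_pdf.
    have -> : K * normal_pdf (- c * s ^+ 2) s x
              = expR (- c * x) * normal_pdf 0 s x.
      by rewrite expR_tilt_normal_pdf// sqrrN.
    rewrite -mulrDl.
    rewrite ler_wpM2r ?normal_pdf_ge0//.
    case: (ger0P x) => _; first by rewrite lerDl expR_ge0.
    by rewrite mulrN mulNr lerDr expR_ge0.
rewrite ge0_integralD; last 5 first.
- by [].
- by move=> x _; rewrite mule_ge0 ?pdf0 ?lee_fin.
- exact: mK.
- by move=> x _; rewrite mule_ge0 ?pdf0 ?lee_fin.
- exact: mK.
rewrite !ge0_integralZl; try by [|move=> x _; exact: pdf0|exact: mpdf|rewrite lee_fin].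
by rewrite !integral_normal_pdf !mule1 -EFinD lee_fin mulr_natl mulr2n.
Qed.

(** [expR (c * `|x|)] is at most the sum of the weights [expR (c * x)] and
    [expR (- c * x)], each of which has moment [expR (c ^+ 2 * s ^+ 2 / 2)]. *)
Lemma normal_expR_abs_le d (Omega : measurableType d) (P : probability Omega R)
    (X : {RV P >-> R}) (c s : R) : s != 0 ->
  (forall U : set R, measurable U -> pushforward P X U = normal_prob 0 s U) ->
  (\int[P]_omega (expR (c * `|X omega|))%:E
   <= (2 * expR (c ^+ 2 * s ^+ 2 / 2))%:E)%E.
Proof.
move=> s0 XE.
pose Z : Omega -> measurableTypeR R := X.
have mZ : measurable_fun [set: Omega] Z by exact: (measurable_funP X).
have mf : measurable_fun [set: measurableTypeR R] (fun x => (expR (c * `|x|))%:E).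
  apply/measurable_EFinP; apply: measurableT_comp => //.
  by apply: measurable_funM => //; exact: measurableT_comp.
rewrite -[leLHS](@ge0_integral_pushforward _ _ _ _ _ Z mZ P
  [set: measurableTypeR R] (fun x => (expR (c * `|x|))%:E))//.
apply: le_trans (integral_expR_abs_normal_pdf c s0).
pose Z_isMeasurable := isMeasurableFun.Build _ _ _ _ _ mZ.
pose mfZ : {mfun Omega >-> measurableTypeR R} := HB.pack Z Z_isMeasurable.
apply: (@ge0_integral_density R _ _ mu [the {measure set (measurableTypeR R) -> \bar R} of (pushforward P mfZ)]).
- by move=> x; exact: normal_pdf_ge0.
- exact: measurable_normal_pdf.
- exact: XE.
- by move=> x; rewrite lee_fin expR_ge0.
- exact: mf.
Qed.

End Gaussian.

(** * Dyadic chaining *)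

Section Chaining.
Context {R : realType}.
Implicit Types (w : R -> R) (T m c t : R).

(** These weights sum to 1 over [n], and they decrease more slowly than the
    standard deviation of a dyadic increment of level [n], whose ratio between
    two levels is the square root of 1/2, less than 3/4. *)
Definition chain_weight (n : nat) : R := (3 / 4) ^+ n / 4.

Lemma chain_weight_gt0 n : 0 < chain_weight n.
Proof. by rewrite /chain_weight divr_gt0// exprn_gt0// divr_gt0. Qed.

(** A point of level [n.+1] is either a point of level [n] or the right end
    of an increment of level [n.+1] that starts at one; the factor on the right
    is the partial sum of the weights. *)
Lemma dyadic_chaining w T m : w 0 = 0 -> 0 <= m ->
  (forall n k, (k < 2 ^ n)%N ->
     `|w (k.+1%:R * T / 2 ^+ n) - w (k%:R * T / 2 ^+ n)| <= chain_weight n * m) ->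
  forall n k, (k <= 2 ^ n)%N ->
    `|w (k%:R * T / 2 ^+ n)| <= (1 - (3 / 4) ^+ n.+1) * m.
Proof.
move=> w0 m0 incr; elim=> [|n IH] k kn.
  have /andP[] : (0 <= k <= 1)%N by [].
  case: k kn => [|[|//]] _ _ _.
    by rewrite mul0r mul0r w0 normr0 mulr_ge0// subr_ge0 expr1; lra.
  have := incr 0%N 0%N isT; rewrite /chain_weight !mul0r w0 subr0 expr0 => /le_trans.
  by apply; rewrite ler_wpM2r// expr1; lra.
have half (j : nat) : (j.*2)%:R * T / 2 ^+ n.+1 = j%:R * T / 2 ^+ n :> R.
  rewrite -muln2 natrM exprS; field.
  by rewrite expf_neq0.
have kE := odd_double_half k; case: (odd k) kE => /= kE; last first.
  rewrite -kE add0n half (le_trans (IH _ _))//.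
    by rewrite -leq_double -[X in (_ <= X)%N]mul2n -expnS; move: kn; rewrite -{1}kE.
  rewrite ler_wpM2r// lerB// exprS ger_pMl ?exprn_gt0//; lra.
have jn : (k./2 < 2 ^ n)%N.
  rewrite -ltn_double -[X in (_ < X)%N]mul2n -expnS.
  by apply: leq_trans kn; rewrite -{2}kE.
have jn2 : (k./2.*2 < 2 ^ n.+1)%N by apply: leq_trans kn; rewrite -{2}kE.
have := incr n.+1 _ jn2; rewrite half -{3}kE add1n => d1.
have d2 := IH _ (ltnW jn).
have := ler_normD (w ((k./2.*2.+1)%:R * T / 2 ^+ n.+1) - w (k./2%:R * T / 2 ^+ n))
  (w (k./2%:R * T / 2 ^+ n)).
rewrite subrK => /le_trans; apply; apply: le_trans (lerD d1 d2) _.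
rewrite -mulrDl ler_wpM2r// /chain_weight ![(3 / 4) ^+ n.+2]exprS; lra.
Qed.

Lemma within_continuousP_dist w : {within `[0, +oo[, continuous w} ->
  forall t, 0 <= t -> forall e, 0 < e ->
  exists2 de, 0 < de & forall s, 0 <= s -> `|s - t| < de -> `|w s - w t| < e.
Proof.
move=> /subspace_continuousP wc t t0 e e0.
have : (`[0, +oo[%classic : set R) t by rewrite /= in_itv /= t0.
move=> /wc /cvgrPdist_lt /(_ e e0); rewrite near_withinE => -[de /= de0 H].
exists de => // s s0 st; rewrite distrC; apply: H => //=.
  by rewrite distrC.
by rewrite in_itv/= s0.
Qed.

Lemma exists_half_pow_lt (a e : R) : 0 < e -> exists n, a / 2 ^+ n < e.
Proof.
move=> e0; pose n := Num.truncn (`|a| / e); exists n.+1.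
rewrite ltr_pdivrMr ?exprn_gt0//.
apply: le_lt_trans (ler_norm a) _.
rewrite -ltr_pdivrMl//.
rewrite mulrC; apply: lt_le_trans (truncnS_gt _) _.
rewrite -natrX ler_nat; apply: ltnW; exact: ltn_expl.
Qed.

Lemma chaining w T m : 0 < T -> w 0 = 0 -> 0 <= m ->
  {within `[0, +oo[, continuous w} ->
  (forall n k, (k < 2 ^ n)%N ->
     `|w (k.+1%:R * T / 2 ^+ n) - w (k%:R * T / 2 ^+ n)| <= chain_weight n * m) ->
  forall t, 0 <= t <= T -> `|w t| <= m.
Proof.
move=> T0 w0 m0 wc incr t /andP[t0 tT]; rewrite leNgt; apply/negP => mwt.
have e0 : 0 < `|w t| - m by rewrite subr_gt0.
have [de de0 H] := within_continuousP_dist wc t0 e0.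
have [n nde] := exists_half_pow_lt T de0.
have p0 : 0 < 2 ^+ n :> R by rewrite exprn_gt0.
pose k := Num.truncn (t * 2 ^+ n / T).
have x0 : 0 <= t * 2 ^+ n / T by rewrite !(divr_ge0, mulr_ge0)// ltW.
have /andP[k1 k2] := truncn_itv x0.
have kt1 : k%:R * T / 2 ^+ n <= t.
  by rewrite ler_pdivrMr// -ler_pdivlMr.
have kt2 : t < k%:R * T / 2 ^+ n + T / 2 ^+ n.
  rewrite -mulrDl ltr_pdivlMr//.
  by move: k2; rewrite ltr_pdivrMr// -[k.+1%:R]natr1 mulrDl mul1r.
have kn : (k <= 2 ^ n)%N.
  rewrite -(ler_nat R) natrX; apply: le_trans k1 _.
  by rewrite ler_pdivrMr// mulrC ler_wpM2l// ltW.
have s0 : 0 <= k%:R * T / 2 ^+ n by rewrite !(divr_ge0, mulr_ge0)// ltW.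
have close : `|k%:R * T / 2 ^+ n - t| < de.
  by rewrite distrC ger0_norm ?subr_ge0//; lra.
have := H _ s0 close.
have := dyadic_chaining w0 m0 incr kn.
have : (1 - (3 / 4) ^+ n.+1) * m <= m.
  by rewrite ler_piMl// lerBlDr lerDl exprn_ge0// divr_ge0.
have := lerB_dist (w t) (w (k%:R * T / 2 ^+ n)); rewrite distrC.
move: (w _) (w t) (_ * m) => x y z; lra.
Qed.

End Chaining.

(** * Exponential moments of the maximum of a Brownian path *)

Section BrownianMaximum.
Context {R : realType} {d : measure_display} {Omega : measurableType d}
  (P : probability Omega R).

(** Bernoulli's inequality for the ratio 20/19. *)
Lemma linear_le_geometric n : n.+1%:R * (19 / 20) ^+ n <= 20 :> R.
Proof.
suff H : n%:R + 19 <= 19 * (20 / 19) ^+ n :> R.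
  have -> : 19 / 20 = (20 / 19)^-1 :> R by rewrite invf_div.
  rewrite exprVn ler_pdivrMr ?exprn_gt0 ?divr_gt0//.
  have : 1 <= (20 / 19) ^+ n :> R by rewrite exprn_ege1// ler_pdivlMr//; lra.
  rewrite -[n.+1%:R]natr1; lra.
elim: n => [|n IH]; first by rewrite expr0; lra.
rewrite exprS -[n.+1%:R]natr1.
have n0 : 0 <= n%:R :> R by [].
have : (20 / 19) * (n%:R + 19) <= (20 / 19) * (19 * (20 / 19) ^+ n) :> R.
  by rewrite ler_wpM2l ?divr_ge0.
move: ((20 / 19) ^+ n) => y; lra.
Qed.

(** Half the variance of an increment of level [n], scaled as in
    [chain_term], is [8 * (c ^+ 2 * T)] times [n.+1 ^+ 2 * (8 / 9) ^+ n]; as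
    8/9 is at most the square of 19/20, that last factor is at most 400. *)
Lemma scaled_variance_bound (c T : R) n : 0 <= T ->
  (n.+1%:R * c / chain_weight n) ^+ 2 * Num.sqrt (T / 2 ^+ n) ^+ 2 / 2
  <= 3200 * (c ^+ 2 * T).
Proof.
move=> T0; rewrite sqr_sqrtr ?divr_ge0 ?exprn_ge0//.
have q0 : (3 : R) ^+ n != 0 by rewrite expf_neq0.
have p0 : (2 : R) ^+ n != 0 by rewrite expf_neq0.
have -> : (n.+1%:R * c / chain_weight n) ^+ 2 * (T / 2 ^+ n) / 2
    = 8 * (c ^+ 2 * T) * (n.+1%:R ^+ 2 * (8 / 9) ^+ n).
  rewrite /chain_weight !expr_div_n.
  have -> : 4 = 2 * 2 :> R by lra.
  have -> : 8 = 2 * 2 * 2 :> R by lra.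
  have -> : 9 = 3 * 3 :> R by lra.
  rewrite !exprMn.
  move: q0 p0; move: (3 ^+ n) (2 ^+ n) (n.+1%:R) => q p k q0 p0.
  by field; rewrite q0 p0.
have -> : 3200 * (c ^+ 2 * T) = 8 * (c ^+ 2 * T) * (20 * 20) by ring.
rewrite ler_wpM2l//; first by rewrite mulr_ge0// mulr_ge0// sqr_ge0.
have le89 : (8 / 9) ^+ n <= ((19 / 20) ^+ n) ^+ 2 :> R.
  rewrite exprAC lerXn2r ?nnegrE ?divr_ge0 ?exprn_ge0 ?divr_ge0//.
  by rewrite expr2; lra.
apply: (@le_trans _ _ (n.+1%:R ^+ 2 * ((19 / 20) ^+ n) ^+ 2)).
  by rewrite ler_wpM2l// exprn_ge0.
rewrite -exprMn expr2 ler_pM ?linear_le_geometric// mulr_ge0// exprn_ge0// divr_ge0//.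
Qed.

Variable W : R -> {RV P >-> R}.
Hypothesis hW : brownian_motion W.

Definition chain_increment (T : R) (n k : nat) (omega : Omega) : R :=
  W (k.+1%:R * T / 2 ^+ n) omega - W (k%:R * T / 2 ^+ n) omega.

(** When the exponential of an increment exceeds 4, its power [n.+1] rather
    than 1 pays for the weight [4^-1 ^+ n]; the weight makes the series over [n]
    of these sums of [2 ^ n] terms integrable. *)
Definition chain_term (c T : R) (n : nat) (omega : Omega) : \bar R :=
  (\sum_(k < 2 ^ n)
    (4^-1 ^+ n)%:E * (expR (n.+1%:R * c / chain_weight n
       * `|chain_increment T n k omega|))%:E)%E.

Definition chain_majorant (c T : R) (omega : Omega) : \bar R :=
  (4%:E + \sum_(n <oo) chain_term c T n omega)%E.

Lemma chain_increment_exp (c T : R) n k : 0 < T ->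
  (\int[P]_omega (expR (n.+1%:R * c / chain_weight n
       * `|chain_increment T n k omega|))%:E
   <= (2 * expR (3200 * (c ^+ 2 * T)))%:E)%E.
Proof.
move=> T0; case: hW => _ _ gaussW _.
have p0 : 0 < 2 ^+ n :> R by rewrite exprn_gt0.
have tD : k.+1%:R * T / 2 ^+ n - k%:R * T / 2 ^+ n = T / 2 ^+ n.
  by rewrite -mulrBl -mulrBl -[k.+1%:R]natr1 addrAC subrr add0r mul1r.
have st : k%:R * T / 2 ^+ n < k.+1%:R * T / 2 ^+ n.
  by rewrite -subr_gt0 tD divr_gt0.
have s0 : 0 <= k%:R * T / 2 ^+ n by rewrite !(divr_ge0, mulr_ge0)// ltW.
have sd0 : Num.sqrt (T / 2 ^+ n) != 0.
  by rewrite sqrtr_eq0 -ltNge divr_gt0.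
have := gaussW _ _ s0 st; rewrite tD => /(normal_expR_abs_le
  (n.+1%:R * c / chain_weight n) sd0) => /le_trans; apply.
by rewrite lee_fin ler_wpM2l// ler_expR scaled_variance_bound// ltW.
Qed.

Let measurable_increment_exp (a T : R) n k :
  measurable_fun [set: Omega] (fun omega =>
    (expR (a * `|chain_increment T n k omega|))%:E).
Proof.
apply/measurable_EFinP; apply: measurableT_comp => //.
apply: measurable_funM => //; apply: measurableT_comp => //.
by apply: measurable_funB; exact: measurable_funP.
Qed.

Let measurable_chain_summand (a e T : R) n k :
  measurable_fun [set: Omega] (fun omega =>
    (e%:E * (expR (a * `|chain_increment T n k omega|))%:E)%E).
Proof.
by apply: emeasurable_funM; [exact: measurable_cst|exact: measurable_increment_exp].
Qed.

Let chain_summand_ge0 (a T : R) n k omega :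
  (0 <= (4^-1 ^+ n)%:E * (expR (a * `|chain_increment T n k omega|))%:E)%E.
Proof. by rewrite -EFinM lee_fin mulr_ge0 ?expR_ge0// exprn_ge0. Qed.

Let measurable_chain_term c T n : measurable_fun [set: Omega] (chain_term c T n).
Proof. by apply: emeasurable_sum => k; exact: measurable_chain_summand. Qed.

Let chain_term_ge0 c T n omega : (0 <= chain_term c T n omega)%E.
Proof. by apply: sume_ge0 => k _; exact: chain_summand_ge0. Qed.

Lemma chain_majorant_ge0 c T omega : (0 <= chain_majorant c T omega)%E.
Proof. by rewrite adde_ge0 ?lee_fin// nneseries_ge0. Qed.

Lemma measurable_chain_majorant c T :
  measurable_fun [set: Omega] (chain_majorant c T).
Proof.
apply: emeasurable_funD; first exact: measurable_cst.
exact: ge0_emeasurable_sum.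
Qed.

Lemma integral_chain_term c T n : 0 < T ->
  (\int[P]_omega chain_term c T n omega
   <= (2^-1 ^+ n * (2 * expR (3200 * (c ^+ 2 * T))))%:E)%E.
Proof.
move=> T0; rewrite /chain_term ge0_integral_sum//.
set K := 2 * _.
apply: (@le_trans _ _ (\sum_(k < 2 ^ n) (4^-1 ^+ n * K)%:E)%E).
  apply: lee_sum => k _; rewrite ge0_integralZl//.
  rewrite EFinM lee_wpmul2l ?lee_fin ?exprn_ge0//; exact: chain_increment_exp.
rewrite sumEFin lee_fin sumr_const card_ord -[_ *+ (2 ^ n)]mulr_natl natrX mulrA -exprMn.
by have -> : 2 / 4 = 2^-1 :> R by lra.
Qed.

Lemma integral_chain_majorant_lty c T : 0 < T ->
  (\int[P]_omega chain_majorant c T omega < +oo)%E.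
Proof.
move=> T0; rewrite ge0_integralD//; last 2 first.
- by move=> x _; rewrite nneseries_ge0.
- exact: ge0_emeasurable_sum.
rewrite lte_add_pinfty//.
  by rewrite integral_cst//= probability_setT mule1 ltry.
rewrite integral_nneseries//.
set K := 2 * expR (3200 * (c ^+ 2 * T)).
have K0 : 0 <= K by rewrite mulr_ge0 ?expR_ge0.
apply: (@le_lt_trans _ _ (2 * K)%:E); last exact: ltry.
apply: lime_le.
  by apply: is_cvg_nneseries => n _ _; exact: integral_ge0.
apply: nearW => n; rewrite big_mkord.
apply: (@le_trans _ _ (\sum_(i < n) (2^-1 ^+ i * K)%:E)%E).
  by apply: lee_sum => i _; exact: integral_chain_term.
rewrite sumEFin lee_fin -mulr_suml ler_wpM2r//.
suff -> : \sum_(i < n) 2^-1 ^+ i = 2 - 2 * 2^-1 ^+ n :> R.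
  by rewrite gerBl mulr_ge0// exprn_ge0.
elim: n => [|n IH]; first by rewrite big_ord0 expr0 mulr1 subrr.
by rewrite big_ord_recr /= IH exprS; lra.
Qed.

(** If the majorant has the finite value [g], then [4 <= g] and each summand
    gives [expR (c * `|increment| / weight) ^+ n.+1 <= 4 ^+ n * g <= g ^+ n.+1],
    so every increment of level [n] is at most [ln g / c] times the weight of
    that level, which is what chaining asks for. *)
Lemma chain_majorantP c T : 0 < c -> 0 < T ->
  {ae P, forall omega t, 0 <= t <= T ->
    ((expR (c * `|W t omega|))%:E <= chain_majorant c T omega)%E}.
Proof.
move=> c0 T0; case: hW => W0 _ _ Wc.
apply: filterS2 W0 Wc => omega w0 wc t tT.
have := chain_majorant_ge0 c T omega.
have : (4%:E <= chain_majorant c T omega)%E.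
  by rewrite leeDl// nneseries_ge0.
have : forall n k, (k < 2 ^ n)%N -> (((4^-1 ^+ n)%:E * (expR (n.+1%:R * c / chain_weight n
       * `|chain_increment T n k omega|))%:E) <= chain_majorant c T omega)%E.
  move=> n k kn; apply: (@le_trans _ _ (chain_term c T n omega)).
    by rewrite /chain_term (bigD1 (Ordinal kn))//= leeDl// sume_ge0.
  apply: (@le_trans _ _ (\sum_(n <oo) chain_term c T n omega)%E); last first.
    by rewrite leeDr.
  apply: le_trans (nneseries_lim_ge n.+1 _); last by [].
  by rewrite big_nat_recr//= leeDr// sume_ge0.
case: (chain_majorant c T omega) => [g| |//] Hk g4 g0; last by rewrite leey.
rewrite lee_fin in g4.
have gp : 0 < g by lra.
rewrite lee_fin -[leRHS](lnK gp) ler_expR mulrC -ler_pdivlMr//.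
apply: (chaining T0 w0 _ wc) => //.
  by rewrite divr_ge0 ?ln_ge0//; lra.
move=> n k /(Hk n k); rewrite -EFinM lee_fin -/(chain_increment T n k omega).
rewrite exprVn ler_pdivrMl ?exprn_gt0// => H.
have {}H : expR (n.+1%:R * c / chain_weight n * `|chain_increment T n k omega|)
   <= expR (n.+1%:R * ln g).
  apply: (le_trans H); rewrite expRM_natl lnK// exprS mulrC.
  by rewrite ler_pM2l// lerXn2r ?nnegrE// ltW.
have aw0 := @chain_weight_gt0 R n.
rewrite ler_expR in H.
rewrite [leRHS]mulrA ler_pdivlMr// [leLHS]mulrC -ler_pdivrMl//.
rewrite -(ler_pM2l (ltr0Sn R n)); apply: le_trans H.
(* The weight is generalized so that rewriting does not unfold it. *)
move: (chain_weight n) `|_| => a x.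
by rewrite -!mulrA [c * (_ * _)]mulrCA.
Qed.

(** The maximum of the path is replaced by a measurable majorant given by a
    countable sum, so that no measurability of a supremum is involved. *)
Lemma brownian_maximum_exp_moment c T : 0 < c -> 0 < T ->
  exists (G : Omega -> \bar R) (I : R),
  [/\ measurable_fun [set: Omega] G, (forall omega, 0 <= G omega)%E, 0 <= I,
      (\int[P]_omega G omega = I%:E)%E
    & {ae P, forall omega t, 0 <= t <= T ->
        ((expR (c * `|W t omega|))%:E <= G omega)%E}].
Proof.
move=> c0 T0; exists (chain_majorant c T), (fine (\int[P]_omega chain_majorant c T omega)%E).
have I0 : (0 <= \int[P]_omega chain_majorant c T omega)%E.
  by apply: integral_ge0 => omega _; exact: chain_majorant_ge0.
split.
- exact: measurable_chain_majorant.
- exact: chain_majorant_ge0.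
- exact: fine_ge0.
- by rewrite fineK// ge0_fin_numE// integral_chain_majorant_lty.
- exact: chain_majorantP.
Qed.

End BrownianMaximum.

(** * Piecewise linear time changes *)

Section TimeChange.
Context {R : realType}.
Implicit Types (T g t x y : R) (s u : nat -> R) (n k : nat).

Definition clamp s k t : R := Num.min (Num.max t (s k)) (s k.+1).

Definition slope s u k : R := (u k.+1 - u k) / (s k.+1 - s k).

(** A sum of clamped linear pieces, rather than a definition by cases: its
    increments are then combinations of the slopes with nonnegative
    coefficients that add up to the increment of time, which gives
    monotonicity, continuity and the bound on [gamma_T] at once. *)
Definition piecewise_linear s u n t : R :=
  \sum_(0 <= k < n) slope s u k * (clamp s k t - s k).

Variables (s u : nat -> R) (n : nat).
Hypothesis s_incr : forall k, (k <= n)%N -> s k < s k.+1.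

Lemma breakpoint_le j k : (j <= k)%N -> (k <= n.+1)%N -> s j <= s k.
Proof.
move=> jk; elim: k jk => [|k IH]; first by rewrite leqn0 => /eqP->.
rewrite leq_eqVlt ltnS => /predU1P[->//|jk] kn.
by rewrite (le_trans (IH jk (ltnW kn)))// ltW// s_incr.
Qed.

Lemma clamp_nondecreasing k x y : x <= y -> clamp s k x <= clamp s k y.
Proof.
move=> xy; rewrite /clamp le_min2// le_max2//.
Qed.

Lemma clamp_right k t : (k <= n)%N -> s k.+1 <= t -> clamp s k t = s k.+1.
Proof.
move=> kn st; rewrite /clamp max_l; last first.
  by rewrite (le_trans _ st)// ltW// s_incr.
by rewrite min_r.
Qed.

Lemma clamp_left k t : (k <= n)%N -> t <= s k -> clamp s k t = s k.
Proof.
by move=> kn st; rewrite /clamp max_r// min_l// ltW// s_incr.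
Qed.

Lemma clamp_mid k t : s k <= t <= s k.+1 -> clamp s k t = t.
Proof. by move=> /andP[st ts]; rewrite /clamp max_l// min_l. Qed.

Lemma sum_clamp j t : s 0%N <= t -> (j <= n.+1)%N ->
  \sum_(0 <= k < j) (clamp s k t - s k) = Num.min t (s j) - s 0%N.
Proof.
move=> st; elim: j => [|j IH] jn.
  by rewrite big_nil min_r// subrr.
rewrite big_nat_recr//= IH; last exact: ltnW.
have sj := s_incr jn.
have [tsj|stj] := leP t (s j).
  rewrite clamp_left// subrr addr0 min_l//.
  by rewrite (le_trans tsj)// ltW.
rewrite /clamp max_l ?ltW//; ring.
Qed.

Lemma piecewise_linear_past j t : (j <= n.+1)%N -> s j <= t ->
  piecewise_linear s u j t = u j - u 0%N.
Proof.
rewrite /piecewise_linear; elim: j => [|j IH] jn sjt.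
  by rewrite big_nil subrr.
have sj := s_incr jn.
rewrite big_nat_recr//= IH; [|exact: ltnW|by rewrite (le_trans _ sjt)// ltW].
rewrite clamp_right// /slope divfK ?subr_eq0 ?gt_eqF//; ring.
Qed.

Lemma piecewise_linearE k t : (k <= n)%N -> s k <= t <= s k.+1 ->
  piecewise_linear s u n.+1 t = u k - u 0%N + slope s u k * (t - s k).
Proof.
move=> kn /andP[st ts].
rewrite /piecewise_linear (big_cat_nat (leq0n k) (leqW kn))/=.
rewrite -/(piecewise_linear s u k t) piecewise_linear_past//; last exact: leqW.
congr (_ + _); rewrite big_ltn ?ltnS// clamp_mid ?st//.
rewrite big_nat_cond big1 ?addr0// => i /andP[/andP[ki]]; rewrite ltnS => i_n _.
rewrite clamp_left ?subrr ?mulr0//.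
by rewrite (le_trans ts)// breakpoint_le// leqW.
Qed.

(** The increments of the clamps over [x <= y] are nonnegative and sum to
    [y - x]. *)
Lemma piecewise_linear_slope_bounds (a c x y : R) :
  (forall k, (k <= n)%N -> a <= slope s u k <= c) ->
  s 0%N <= x -> x <= y -> y <= s n.+1 ->
  a * (y - x) <= piecewise_linear s u n.+1 y - piecewise_linear s u n.+1 x
    <= c * (y - x).
Proof.
move=> ac sx xy yT.
have -> : y - x = \sum_(0 <= k < n.+1) (clamp s k y - clamp s k x).
  transitivity (\sum_(0 <= k < n.+1) (clamp s k y - s k) -
                \sum_(0 <= k < n.+1) (clamp s k x - s k)).
    rewrite !sum_clamp ?(le_trans sx)// !min_l ?(le_trans xy)//; ring.
  rewrite -sumrB; apply: eq_bigr => k _; ring.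
have -> : piecewise_linear s u n.+1 y - piecewise_linear s u n.+1 x
    = \sum_(0 <= k < n.+1) slope s u k * (clamp s k y - clamp s k x).
  rewrite /piecewise_linear -sumrB; apply: eq_bigr => k _; ring.
by rewrite !mulr_sumr; apply/andP; split;
  rewrite big_nat_cond [leRHS]big_nat_cond; apply: ler_sum => k /andP[/andP[_ kn] _];
  have /andP[ak ck] := ac k kn; rewrite ler_wpM2r// subr_ge0 clamp_nondecreasing.
Qed.

End TimeChange.

Lemma piecewise_linear_time_change (R : realType) (s u : nat -> R) (n : nat)
    (T g : R) :
  s 0%N = 0 -> u 0%N = 0 -> s n.+1 = T -> u n.+1 = T ->
  (forall k, (k <= n)%N -> s k < s k.+1) ->
  (forall k, (k <= n)%N -> expR (- g) <= slope s u k <= expR g) ->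
  time_change T (piecewise_linear s u n.+1) /\
  (gamma_T T (piecewise_linear s u n.+1) <= g%:E)%E.
Proof.
move=> s0 u0 sT uT si slopeP; set lam := piecewise_linear s u n.+1.
have T0 : 0 < T.
  by rewrite -s0 -sT (lt_le_trans (si 0%N _))// (breakpoint_le si).
have bnd x y : 0 <= x -> x <= y -> y <= T ->
    expR (- g) * (y - x) <= lam y - lam x <= expR g * (y - x).
  by move=> x0 xy yT; apply: (piecewise_linear_slope_bounds si slopeP); rewrite ?s0 ?sT.
have incr x y : 0 <= x -> x < y -> y <= T -> lam x < lam y.
  move=> x0 xy yT; have /andP[+ _] := bnd _ _ x0 (ltW xy) yT.
  rewrite -subr_gt0; apply: lt_le_trans; by rewrite mulr_gt0 ?expR_gt0// subr_gt0.
have lam0 : lam 0 = 0.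
  rewrite /lam (@piecewise_linearE _ s u n si 0%N)// ?s0 ?u0 ?lexx/=.
    by rewrite !subrr mulr0 addr0.
  by rewrite -s0 ltW// si.
have lamT : lam T = T.
  by rewrite /lam (@piecewise_linear_past _ s u n si)// ?sT// uT u0 subr0.
have gam : (gamma_T T lam <= g%:E)%E.
  apply: ge_ereal_sup => _ [[x y] /= [x0 xy yT] <-].
  have yx0 : 0 < y - x by rewrite subr_gt0.
  have /andP[l1 l2] := bnd _ _ x0 (ltW xy) yT.
  have q0 : 0 < (lam y - lam x) / (y - x) by rewrite divr_gt0// subr_gt0 incr.
  rewrite lee_fin ler_norml -[- g <= _]ler_expR -[X in _ && X]ler_expR lnK//.
  by rewrite ler_pdivlMr// l1 ler_pdivrMr.
have lip x y : 0 <= x <= T -> 0 <= y <= T ->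
    `|lam x - lam y| <= expR g * `|x - y|.
  wlog yx : x y / y <= x => [H xT yT|].
    have [yx|/ltW xy] := leP y x; first exact: H.
    by rewrite distrC [`|x - y|]distrC; exact: H.
  move=> /andP[x0 xT] /andP[y0 yT].
  have lyx : lam y <= lam x.
    by move: yx; rewrite le_eqVlt => /predU1P[->//|yx]; rewrite ltW// incr.
  by rewrite !ger0_norm ?subr_ge0//; have /andP[] := bnd _ _ y0 yx xT.
have cont : {within `[0, T], continuous lam}.
  apply/subspace_continuousP => x /=; rewrite in_itv/= => xT.
  apply/cvgrPdist_le => e e0; rewrite near_withinE.
  exists (e / expR g) => /=; first by rewrite divr_gt0// expR_gt0.
  move=> y /= xy; rewrite in_itv/= => yT.
  apply: (@le_trans _ _ (expR g * `|x - y|)); last first.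
    by rewrite mulrC -ler_pdivlMr ?expR_gt0// ltW.
  exact: lip.
have mono x y : 0 <= x -> x <= y -> y <= T -> lam x <= lam y.
  by move=> x0; rewrite le_eqVlt => /predU1P[->//|xy] yT; rewrite ltW// incr.
split => //; split => //; last exact: le_lt_trans gam (ltry _).
split.
- move=> x /=; rewrite !in_itv/= => /andP[x0 xT].
  by rewrite -{1}lam0 -lamT !mono.
- move=> x y; rewrite !inE /= !in_itv/= => /andP[x0 xT] /andP[y0 yT] lxy.
  have [xy|yx|//] := ltgtP x y.
    by have := incr _ _ x0 xy yT; rewrite lxy ltxx.
  by have := incr _ _ y0 yx xT; rewrite lxy ltxx.
- move=> v /=; rewrite in_itv/= => /andP[v0 vT].
  have [|c cT <-] := @IVT _ lam 0 T v (ltW T0) cont.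
    by rewrite lam0 lamT min_l ?max_r ?(ltW T0)// v0 vT.
  by exists c.
Qed.

(** * Gronwall's lemma *)

Section Gronwall.
Context {R : realType}.
Implicit Types (g : R -> R) (L c : R).

(** The function [(g ^+ 2 + c ^+ 2) * expR (- (2 * L + 1) * x)] is
    nonincreasing, because the derivative of [g ^+ 2] is at most
    [2 * L * g ^+ 2 + 2 * c * `|g|] and [2 * c * `|g| <= g ^+ 2 + c ^+ 2].
    Squares avoid differentiating [`|g|]. *)
Lemma gronwall g L c (s t : R) : s <= t -> 0 <= L -> 0 <= c ->
  {within `[s, t], continuous g} ->
  (forall x, x \in `]s, t[ -> derivable g x 1 /\ `|g^`()%classic x| <= L * `|g x| + c) ->
  `|g t| <= expR ((2 * L + 1) * (t - s)) * (`|g s| + c).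
Proof.
move=> st L0 c0 cg dg; set K := 2 * L + 1.
have K1 : 1 <= K by rewrite /K; lra.
pose phi (x : R) := expR (- K * x) * (g x ^+ 2 + c ^+ 2).
have dphi x : x \in `]s, t[ -> is_derive x 1 phi
    (expR (- K * x) * (2 * g x * g^`()%classic x - K * (g x ^+ 2 + c ^+ 2))).
  move=> /dg[dgx _].
  have {}dgx : is_derive x 1 g (g^`()%classic x) by rewrite derive1E; exact: DeriveDef.
  apply: is_derive_eq.
  rewrite addr0 /GRing.scale /= mulr1.
  move: (g x) (g^`()%classic x) (expR _) => a a' e; rewrite /K; ring.
have phi_le : phi t <= phi s.
  suff H : {in `[s, t] &, {homo phi : x y /~ x <= y}}.
    by apply: H => //; rewrite in_itv/= lexx ?st.
  apply: ler0_derive1_le_cc.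
  - by move=> x /dphi [].
  - move=> x xst; have [_ dgx] := dg x xst.
    rewrite derive1E; have [_ ->] := dphi x xst.
    rewrite pmulr_rle0 ?expR_gt0// subr_le0.
    have : 2 * g x * g^`()%classic x <= 2 * (`|g x| * (L * `|g x| + c)).
      rewrite -mulrA ler_wpM2l//; apply: le_trans (ler_norm _) _.
      by rewrite normrM ler_wpM2l.
    move/le_trans; apply.
    rewrite -[g x ^+ 2]real_normK ?num_real//.
    have : 0 <= `|g x| by [].
    move: `|g x| => a a0; rewrite /K.
    have := sqr_ge0 (a - c); have := sqr_ge0 c.
    rewrite !expr2 => h1 h2.
    have : 0 <= L * (c * c) by rewrite mulr_ge0.
    nra.
  - apply/subspace_continuousP => x xst.
    have /subspace_continuousP/(_ x xst) gx := cg.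
    apply: cvgM.
      apply: cvg_within_filter; apply: continuous_comp; last exact: continuous_expR.
      by apply: cvgM; [exact: cvg_cst|exact: cvg_id].
    by apply: cvgD; [apply: cvgM; exact: gx|exact: cvg_cst].
have {phi_le} sq : g t ^+ 2 + c ^+ 2 <= expR (K * (t - s)) * (g s ^+ 2 + c ^+ 2).
  move: phi_le; rewrite /phi !mulNr !expRN.
  rewrite -ler_pdivlMl ?invr_gt0 ?expR_gt0// invrK mulrA => /le_trans; apply.
  by rewrite mulrBr expRD expRN.
have E1 : 1 <= expR (K * (t - s)).
  rewrite -expR0 ler_expR mulr_ge0// ?subr_ge0//; lra.
move: E1 sq; move: (expR _) => E E1 sq.
rewrite -ler_sqr ?nnegrE// ?mulr_ge0 ?addr_ge0//; last lra.
rewrite real_normK ?num_real//.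
apply: (@le_trans _ _ (g t ^+ 2 + c ^+ 2)); first by rewrite lerDl sqr_ge0.
apply: (le_trans sq).
rewrite exprMn [E ^+ 2]expr2 -mulrA ler_wpM2l//; first lra.
rewrite -[g s ^+ 2]real_normK ?num_real//.
apply: (@le_trans _ _ ((`|g s| + c) ^+ 2)); last by rewrite ler_peMl// sqr_ge0.
rewrite sqrrD lerD2r lerDl mulrn_wge0// mulr_ge0//.
Qed.

End Gronwall.

(** * The radial equation between two impacts *)

Section RightContinuous.
Context {R : realType}.
Implicit Types (y : R -> R) (t : R).

(** Such a function is the pointwise limit of its values at the next point
    of the grid of mesh [n.+1%:R^-1], which are constant on grid intervals. *)
Lemma right_continuous_measurable y :
  (forall t, 0 <= t -> y s @[s --> t^'+] --> y t) ->
  measurable_fun (`[0, +oo[%classic : set R) y.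
Proof.
move=> yr.
pose I n k : set R := `[k%:R / n.+1%:R, k.+1%:R / n.+1%:R[%classic.
pose grid n t : R := (Num.truncn (t * n.+1%:R)).+1%:R / n.+1%:R.
have gridI n k t : I n k t -> grid n t = k.+1%:R / n.+1%:R.
  rewrite /I /grid /= in_itv/= ler_pdivrMr// ltr_pdivlMr// => kt.
  by rewrite (truncn_def kt).
have tI n t : 0 <= t -> I n (Num.truncn (t * n.+1%:R)) t.
  move=> t0; rewrite /I /= in_itv/= ler_pdivrMr// ltr_pdivlMr//.
  by apply: truncn_itv; rewrite mulr_ge0.
have covI n : (`[0, +oo[%classic : set R) = \bigcup_k I n k.
  apply/seteqP; split => [t /=|t [k _]]; rewrite /I /= !in_itv/= ?andbT.
    by move=> t0; exists (Num.truncn (t * n.+1%:R)) => //; exact: tI.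
  by move=> /andP[+ _]; apply: le_trans; rewrite divr_ge0.
apply: (@measurable_fun_cvg _ _ _ _ (fun n t => y (grid n t))).
  move=> n; rewrite (covI n); apply/measurable_fun_bigcup => [k|k].
    exact: measurable_itv.
  apply: (@eq_measurable_fun _ _ _ _ _ (cst (y (k.+1%:R / n.+1%:R)))) => //.
  by move=> t; rewrite inE => /gridI ->.
move=> t /=; rewrite in_itv/= andbT => t0.
apply/cvgrPdist_lt => e e0.
have /cvgrPdist_lt/(_ e e0) := yr t t0.
rewrite near_withinE => -[de /= de0 H].
near=> n; apply: H => /=; last first.
  have := tI n t t0; rewrite /I /= in_itv/= => /andP[_]; exact.
have := tI n t t0; rewrite /I /= in_itv/= => /andP[h1 h2].
rewrite distrC ger0_norm ?subr_ge0 ?(ltW h2)//.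
apply: (@le_lt_trans _ _ (n.+1%:R^-1)).
  rewrite lerBlDr; apply: (@le_trans _ _ (n.+1%:R^-1 +
    (Num.truncn (t * n.+1%:R))%:R / n.+1%:R)); last by rewrite lerD2l.
  by rewrite /grid -[X in X / _]natr1 mulrDl mul1r addrC.
by near: n; exact: near_infty_natSinv_lt (PosNum de0).
Unshelve. all: by end_near. Qed.

Lemma llim_cvg y t : cadlag y -> 0 < t -> y s @[s --> t^'-] --> llim y t.
Proof.
move=> [_ yl] t0; rewrite /llim gt_eqF//; exact: yl.
Qed.

Lemma rlim_cadlag y t : cadlag y -> 0 <= t -> rlim y t = y t.
Proof. by move=> [yr _] t0; rewrite /rlim; apply/cvg_lim => //; exact: yr. Qed.

End RightContinuous.

Section DriftPiece.
Context {R : realType}.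
Local Notation mu := (@lebesgue_measure R).
Variables (b : R -> R) (M L : R).
Hypotheses (bc : continuous b) (bM : forall x, `|b x| <= M).

Definition drift_integral (x : R -> R) (s t : R) : R :=
  \int[mu]_(r in `[s, t]) b (x r).

(** Makes the integral in the equations of motion a genuine one. *)
Lemma cadlag_drift_integrable (x : R -> R) (s t : R) : cadlag x -> 0 <= s ->
  mu.-integrable `[s, t] (EFin \o (b \o x)).
Proof.
move=> [xr _] s0; apply: measurable_bounded_integrable.
- exact: measurable_itv.
- rewrite /= lebesgue_measure_itv/=; case: ifP => _; exact: ltry.
- apply: measurableT_comp; first exact: continuous_measurable_fun.
  apply: measurable_funS (right_continuous_measurable xr).
    exact: measurable_itv.
  by move=> r /=; rewrite !in_itv/= andbT => /andP[/(le_trans s0)].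
- exists M; split; first exact: num_real.
  by move=> K MK r _ /=; rewrite (le_trans (bM _))// ltW.
Qed.

Lemma drift_integral_le (x : R -> R) (s t : R) : cadlag x -> 0 <= s -> s <= t ->
  `|drift_integral x s t| <= M * (t - s).
Proof.
move=> xc s0 st; have xi := cadlag_drift_integrable t xc s0.
apply: (le_trans (le_normr_Rintegral _ xi)); first exact: measurable_itv.
apply: (@le_trans _ _ (\int[mu]_(r in `[s, t]) M)); last first.
  rewrite Rintegral_cst//= ?lebesgue_measure_itv/= ?lte_fin.
  move: st; rewrite le_eqVlt => /predU1P[->|st]; last by rewrite st.
  by rewrite ltxx subrr mulr0.
apply: le_Rintegral; first exact: measurable_itv.
- exact: integrable_norm xi.
- apply: measurable_bounded_integrable => //.
    rewrite /= lebesgue_measure_itv/=; case: ifP => _; exact: ltry.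
  by exists `|M|; split => [|K /ltW MK r _ /=]; [exact: num_real|exact: MK].
- by move=> r _ /=; exact: bM.
Qed.

(** The noise [z] is arbitrary, so that the deterministic system is the case
    of a constant [z]. *)
Definition solves_on (x z : R -> R) (s t : R) : Prop :=
  forall r, s <= r <= t -> x r = x s + drift_integral x s r + (z r - z s).

(** The equation itself shows that the path is continuous inside the
    interval, hence that the fundamental theorem of calculus applies. *)
Lemma drift_integral_derive (x z : R -> R) (s t r : R) : cadlag x -> 0 <= s ->
  s < r < t -> solves_on x z s t -> {for r, continuous z} ->
  is_derive r 1 (drift_integral x s) (b (x r)).
Proof.
move=> xc s0 /andP[sr rt] xz zr.
have xi := cadlag_drift_integrable t xc s0.
have st := lt_trans sr rt.
have rst : r \in `]s, t[ by rewrite in_itv/= sr.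
have Fc : {for r, continuous (drift_integral x s)}.
  apply: (within_continuous_continuous st) rst.
  exact: (parameterized_integral_continuous (ltW st) xi).
have xcont : {for r, continuous x}.
  have : x s + drift_integral x s r' + (z r' - z s) @[r' --> r] -->
         x s + drift_integral x s r + (z r - z s).
    apply: cvgD; first by apply: cvgD; [exact: cvg_cst|exact: Fc].
    by apply: cvgB; [exact: zr|exact: cvg_cst].
  rewrite -xz ?(ltW sr) ?(ltW rt)//; apply: cvg_trans; apply: near_eq_cvg.
  near=> r'; rewrite -xz//; apply/andP; split.
    by apply/ltW; near: r'; exact: lt_nbhsr.
  by apply/ltW; near: r'; exact: lt_nbhsl.
have bx : {for r, continuous (b \o x)} by apply: continuous_comp => //; exact: bc.
have [df dE] := continuous_FTC1_closed rt xi sr bx.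
by rewrite -[b (x r)]/((b \o x) r) -dE derive1E; exact: DeriveDef.
Unshelve. all: by end_near. Qed.

Hypotheses (L0 : 0 <= L) (bL : forall x y, `|b x - b y| <= L * `|x - y|).

(** Subtracting the noise leaves a differentiable difference [g] of drift
    integrals, with derivative [b (x r) - m * b (y (lam r))]; as
    [x r - y (lam r)] differs from [g r] by at most [rho], that derivative is at
    most [L * `|g r|] plus the error terms, and Gronwall's lemma applies. *)
Lemma compare_solutions (x y z : R -> R) (s t u m rho : R) :
  cadlag x -> cadlag y -> 0 <= s -> s <= t -> 0 <= u -> 0 < m -> 0 <= rho ->
  solves_on x z s t -> solves_on y (cst 0) u (u + m * (t - s)) ->
  {in `]s, t[, continuous z} -> (forall r, s <= r <= t -> `|z r - z s| <= rho) ->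
  `|x t - y (u + m * (t - s))|
  <= rho + expR ((2 * L + 1) * (t - s)) * (`|x s - y u| + (L * rho + `|1 - m| * M)).
Proof.
move=> xc yc s0 st u0 m0 rho0 xz yz zc zrho.
have M0 : 0 <= M by exact: le_trans (normr_ge0 _) (bM 0).
pose lam r := u + m * (r - s).
pose g r := (x s + drift_integral x s r) - (y u + drift_integral y u (lam r)).
have lamP r : s <= r <= t -> u <= lam r <= lam t.
  move=> /andP[sr rt]; rewrite /lam lerDl mulr_ge0 ?(ltW m0) ?subr_ge0//=.
  by rewrite lerD2l ler_pM2l// lerD2r.
have xyE r : s <= r <= t -> x r - y (lam r) = g r + (z r - z s).
  by move=> rst; rewrite xz// yz ?lamP// /g subrr; ring.
have gs : g s = x s - y u.
  by have := xyE s; rewrite lexx st subrr addr0 /lam subrr mulr0 addr0 => ->.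
have dlam (r : R) : is_derive r 1 lam m.
  by apply: is_derive_eq; rewrite /GRing.scale/=; ring.
have clam : continuous lam.
  by move=> r; apply: differentiable_continuous; apply/derivable1_diffP; case: (dlam r).
have cg : {within `[s, t], continuous g}.
  move: st; rewrite le_eqVlt => /predU1P[<-|st'].
    by rewrite set_itv1; exact: continuous_subspace1.
  have ut : u <= lam t by have /lamP/andP[+ _] : s <= t <= t by rewrite ltW //= lexx.
  apply/subspace_continuousP => r rst; apply: cvgB; apply: cvgD; try exact: cvg_cst.
    have := parameterized_integral_continuous (ltW st') (cadlag_drift_integrable t xc s0).
    by move=> /subspace_continuousP; exact.
  have := parameterized_integral_continuous ut (cadlag_drift_integrable (lam t) yc u0).
  move=> /subspace_continuousP /(_ (lam r)) H; rewrite /= in_itv/= in H rst.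
  have {}H := H (lamP _ rst).
  apply: cvg_comp H => Q; rewrite /within/= => HQ.
  have : \forall r' \near r, `[u, lam t]%classic (lam r') -> Q (lam r') by exact: (clam r _ HQ).
  apply: filterS => r' Hr' r'st; apply: Hr' => /=.
  by rewrite in_itv/= lamP.
have dg r : r \in `]s, t[ ->
    is_derive r 1 g (b (x r) - m * b (y (lam r))).
  rewrite in_itv/= => /andP[sr rt].
  have lr : u < lam r < lam t.
    by rewrite /lam ltrDl mulr_gt0 ?subr_gt0//= ltrD2l ltr_pM2l// ltrD2r.
  have dx : is_derive r 1 (drift_integral x s) (b (x r)).
    by apply: (@drift_integral_derive x z s t); rewrite ?sr ?rt//; apply: zc; rewrite in_itv/= sr.
  have dy : is_derive (lam r) 1 (drift_integral y u) (b (y (lam r))).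
    by apply: (@drift_integral_derive y (cst 0) u (lam t)) => //; exact: cst_continuous.
  have dyl := is_derive1_comp dy (dlam r).
  rewrite /g; apply: is_derive_eq; rewrite !add0r; ring.
have gg : `|g t| <= expR ((2 * L + 1) * (t - s)) * (`|g s| + (L * rho + `|1 - m| * M)).
  apply: gronwall => //; first by rewrite addr_ge0 ?mulr_ge0.
  move=> r rst; have dgr := dg r rst; split; first by case: dgr.
  rewrite derive1E; have [_ ->] := dgr.
  move: rst; rewrite in_itv/= => /andP[/ltW sr /ltW rt].
  have -> : b (x r) - m * b (y (lam r)) =
    (b (x r) - b (y (lam r))) + (1 - m) * b (y (lam r)) by ring.
  apply: (le_trans (ler_normD _ _)); rewrite addrA lerD//; last first.
    by rewrite normrM ler_wpM2l.
  apply: (le_trans (bL _ _)); rewrite -mulrDr ler_wpM2l//.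
  rewrite xyE ?sr//; apply: (le_trans (ler_normD _ _)); rewrite lerD2l.
  by apply: zrho; rewrite sr.
rewrite -/(lam t) xyE ?st ?lexx// addrC; apply: (le_trans (ler_normD _ _)).
by rewrite lerD// ?zrho ?st ?lexx// -gs.
Qed.

Lemma solution_growth (x z : R -> R) (s t rho : R) :
  cadlag x -> 0 <= s -> s <= t -> solves_on x z s t -> `|z t - z s| <= rho ->
  `|x t| <= `|x s| + M * (t - s) + rho.
Proof.
move=> xc s0 st xz zrho; rewrite xz ?st ?lexx//.
apply: (le_trans (ler_normD _ _)); rewrite lerD//.
apply: (le_trans (ler_normD _ _)); rewrite lerD2l; exact: drift_integral_le.
Qed.

End DriftPiece.

(** * Impact times and impulsive paths *)

Section ImpulsivePaths.
Context {R : realType}.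
Implicit Types (b h x z v w : R -> R) (T : R) (n : nat) (s : nat -> R).

(** What the radial estimates use of a path on [[0, T]] with [n] impacts at
    the times [s 1, ..., s n]. It covers both the perturbed and the
    deterministic system. *)
Definition impulsive_path b h (r0 : R) x z T n s : Prop :=
  [/\ s 0%N = 0 /\ s n <= T,
      (forall k, (k < n)%N -> s k < s k.+1),
      cadlag x /\ x 0 = r0,
      (forall k, (k < n)%N -> x (s k.+1) = h (llim x (s k.+1)))
    & (forall k t, (k < n)%N -> s k <= t < s k.+1 -> solves_on b x z (s k) t) /\
      solves_on b x z (s n) T].

Lemma llim_eq_continuous (y f : R -> R) (s t : R) : 0 < t -> s < t ->
  {for t, continuous f} -> (forall r, s <= r < t -> y r = f r) -> llim y t = f t.
Proof.
move=> t0 st ft yf; rewrite /llim gt_eqF//; apply/cvg_lim => //.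
apply: (@cvg_trans _ (f r @[r --> t^'-])); last exact/cvg_at_left_filter/ft.
apply: near_eq_cvg; near=> r; rewrite yf//; apply/andP; split.
  by apply/ltW; near: r; exact: nbhs_left_gt.
by near: r; exact: nbhs_left_lt.
Unshelve. all: by end_near. Qed.

Lemma within_continuous_at v : {within `[0, +oo[, continuous v} ->
  forall t : R, 0 < t -> {for t, continuous (v : R -> R)}.
Proof.
move=> /continuous_within_itvcyP[vc _] t t0; apply: vc.
by rewrite in_itv/= t0.
Qed.

Section ImpactTimes.
Variables (alpha : R) (theta v : R -> R) (e : R).
Hypothesis alpha0 : 0 < alpha.
Hypotheses (vc : {within `[0, +oo[, continuous v}) (v0 : v 0 = 0).
Local Notation tau := (impact_time alpha theta).
Local Notation sigma k := (fine (tau k)).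
Hypothesis cover : forall t, 0 <= t -> exists k, (tau k <= t%:E < tau k.+1)%E.
Hypothesis thetaE : forall k t, (tau k <= t%:E < tau k.+1)%E ->
  theta t = (t - sigma k) + e * (v t - v (sigma k)).

Lemma impact_time_leS k : (tau k <= tau k.+1)%E.
Proof. by apply: le_ereal_inf_tmp => _ [t [/= kt _] <-]; exact: ltW. Qed.

Lemma impact_time_le j k : (j <= k)%N -> (tau j <= tau k)%E.
Proof.
elim: k => [|k IH]; first by rewrite leqn0 => /eqP->.
rewrite leq_eqVlt => /predU1P[->//|/IH] /le_trans; apply; exact: impact_time_leS.
Qed.

Lemma impact_time_ge0 k : (0 <= tau k)%E.
Proof. exact: (impact_time_le (leq0n k)). Qed.

Lemma impact_time_fineK k : (tau k < +oo)%E -> tau k = (sigma k)%:E.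
Proof. by move=> kfin; rewrite fineK// ge0_fin_numE// impact_time_ge0. Qed.

Lemma sigma_ge0 k : 0 <= sigma k.
Proof. by rewrite fine_ge0// impact_time_ge0. Qed.

(** If two consecutive impact times were equal and finite, all later ones
    would be equal to them, and this instant would lie in none of the intervals
    that cover the time axis. *)
Lemma impact_time_ltS k : (tau k < +oo)%E -> (tau k < tau k.+1)%E.
Proof.
move=> kfin; rewrite lt_neqAle impact_time_leS andbT; apply/negP => /eqP kk1.
have stuck j : tau (k + j)%N = tau k.
  elim: j => [|j IH]; first by rewrite addn0.
  by rewrite addnS /= IH [RHS]kk1.
have [j] := cover (sigma_ge0 k); rewrite -impact_time_fineK// => /andP[_].
apply/negP; rewrite -leNgt; have [jk|kj] := ltnP j k.
  exact: impact_time_le.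
by rewrite -(subnKC kj) -addnS stuck.
Qed.

(** The infimum is attained: otherwise the times that define the impact
    time of index [k.+1] would all come strictly after it, and so the next
    impact time would not be larger. *)
Lemma llim_at_impact k : (tau k.+1 < +oo)%E -> llim theta (sigma k.+1) = alpha.
Proof.
move=> k1fin; have k1E := impact_time_fineK k1fin.
apply: contrapT => hn.
have := impact_time_ltS k1fin; rewrite ltNge => /negP; apply.
apply: ereal_inf_le_tmp => _ [t [/= kt lt] <-]; exists t => //=; split => //.
rewrite lt_neqAle; apply/andP; split.
  apply/negP => /eqP; rewrite -[LHS]/(tau k.+1) k1E => -[st].
  by apply: hn; rewrite st.
by apply: ereal_inf_lbound; exists t.
Qed.

Lemma llim_between_impacts k t : (tau k < t%:E)%E -> (t%:E < tau k.+1)%E ->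
  llim theta t <> alpha.
Proof.
move=> kt tk1 lt; move: tk1; rewrite ltNge => /negP; apply.
by apply: ereal_inf_lbound; exists t.
Qed.

Let phi k (t : R) := (t - sigma k) + e * (v t - v (sigma k)).

Let phi_cont k (t : R) : 0 < t -> {for t, continuous (phi k)}.
Proof.
move=> t0; apply: cvgD; first by apply: cvgB; [exact: cvg_id|exact: cvg_cst].
apply: cvgM; first exact: cvg_cst.
by apply: cvgB; [exact: (within_continuous_at vc)|exact: cvg_cst].
Qed.

Let llim_phi k t : (tau k < t%:E)%E -> (t%:E <= tau k.+1)%E ->
  llim theta t = phi k t.
Proof.
move=> kt tk1.
have kE : tau k = (sigma k)%:E by rewrite -impact_time_fineK// (lt_trans kt)// ltry.
rewrite kE lte_fin in kt.
have t0 : 0 < t by exact: le_lt_trans (sigma_ge0 k) kt.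
apply: (@llim_eq_continuous _ _ (sigma k)) => //; first exact: phi_cont.
move=> r /andP[kr rt]; apply: thetaE; rewrite kE lee_fin kr /=.
by apply: lt_le_trans tk1; rewrite lte_fin.
Qed.

(** Between two impacts the angle runs from 0 to [alpha]; the angular
    equations telescope. *)
Lemma angle_at_impact k : (tau k < +oo)%E ->
  sigma k + e * v (sigma k) = k%:R * alpha.
Proof.
elim: k => [|k IH] kfin; first by rewrite /= v0 mulr0 mul0r addr0.
have kfin' : (tau k < +oo)%E := le_lt_trans (impact_time_leS k) kfin.
have := llim_at_impact kfin; rewrite (@llim_phi k); last 2 first.
- by rewrite -impact_time_fineK// impact_time_ltS.
- by rewrite -impact_time_fineK.
rewrite /phi -[k.+1%:R]natr1 mulrDl mul1r; have := IH kfin'; lra.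
Qed.

(** By the intermediate value theorem: an angle at or above [alpha] would
    have met [alpha] before time [t], producing an earlier impact. *)
Lemma angle_before_impact k t : (tau k <= t%:E < tau k.+1)%E ->
  t + e * v t < k.+1%:R * alpha.
Proof.
move=> /andP[kt tk1].
have kfin : (tau k < +oo)%E by rewrite (le_lt_trans kt)// ltry.
have kE := impact_time_fineK kfin.
rewrite kE lee_fin in kt.
suff : phi k t < alpha.
  rewrite /phi -[k.+1%:R]natr1 mulrDl mul1r; have := angle_at_impact kfin; lra.
rewrite ltNge; apply/negP => at_.
have phi0 : phi k (sigma k) = 0 by rewrite /phi !subrr mulr0 addr0.
have phic : {within `[sigma k, t], continuous (phi k)}.
  have /continuous_subspaceW wv : `[sigma k, t]%classic `<=` (`[0, +oo[%classic : set R).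
    move=> r /=; rewrite !in_itv/= andbT => /andP[+ _]; apply: le_trans; exact: sigma_ge0.
  apply/subspace_continuousP => r rkt.
  have /subspace_continuousP/(_ r rkt) vr := wv _ _ vc.
  apply: cvgD; first by apply: cvgB; [apply: cvg_within_filter; exact: cvg_id|exact: cvg_cst].
  apply: cvgM; first exact: cvg_cst.
  by apply: cvgB; [exact: vr|exact: cvg_cst].
have [|c] := @IVT _ (phi k) (sigma k) t alpha kt phic.
  by rewrite phi0 ge_min le_max (ltW alpha0) at_ orbT.
rewrite in_itv/= le_eqVlt => /andP[/predU1P[<-|kc] ct phic_].
  have a0 : alpha = 0 := etrans (esym phic_) phi0.
  by move: alpha0; rewrite a0 ltxx.
have ck1 : (c%:E < tau k.+1)%E by rewrite (le_lt_trans _ tk1)// lee_fin.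
have kc' : (tau k < c%:E)%E by rewrite kE lte_fin.
by apply: (llim_between_impacts kc' ck1); rewrite (llim_phi kc')// ltW.
Qed.

End ImpactTimes.

Lemma perturbed_solution_impulsive_path b h (alpha r0 p eps T : R) w v x theta :
  0 < alpha -> 0 <= T ->
  {within `[0, +oo[, continuous v} -> v 0 = 0 ->
  perturbed_solution b h alpha r0 p eps w v x theta ->
  exists n s,
    [/\ impulsive_path b h r0 x (fun t => eps * w t) T n s,
        (forall k, (k <= n)%N -> s k + eps `^ p * v (s k) = k%:R * alpha),
        T + eps `^ p * v T < n.+1%:R * alpha
      & forall k t, (k <= n)%N -> s k <= t <= T -> (k < n)%N ==> (t < s k.+1) ->
          theta t = (t - s k) + eps `^ p * (v t - v (s k))].
Proof.
move=> alpha0 T0 vc v0; rewrite /perturbed_solution.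
set tau := impact_time alpha theta => -[[xc _] cover x0 jump eqs].
have thetaE k t : (tau k <= t%:E < tau k.+1)%E ->
  theta t = (t - fine (tau k)) + eps `^ p * (v t - v (fine (tau k))).
  by move=> /eqs[].
have [n nT] := cover T T0; exists n, (fun k => fine (tau k)).
have /andP[n1 n2] := nT.
have kfin k : (k <= n)%N -> (tau k < +oo)%E.
  move=> kn; rewrite (le_lt_trans (impact_time_le _ _ kn))//.
  by rewrite (le_lt_trans n1)// ltry.
have kE k : (k <= n)%N -> tau k = (fine (tau k))%:E.
  by move=> kn; apply: impact_time_fineK; exact: kfin.
have solve k t : (k <= n)%N -> fine (tau k) <= t -> (t%:E < tau k.+1)%E ->
    solves_on b x (fun t => eps * w t) (fine (tau k)) t.
  move=> kn kt tk1 r /andP[kr rt].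
  have rk : (tau k <= r%:E < tau k.+1)%E.
    by rewrite kE// lee_fin kr /= (le_lt_trans _ tk1)// lee_fin.
  have [-> _] := eqs k r rk.
  by rewrite rlim_cadlag ?sigma_ge0// /drift_integral mulrBr.
split.
- split.
  + by split => //; rewrite -lee_fin -kE.
  + move=> k kn; rewrite -lte_fin -!kE ?(ltnW kn)//.
    by apply: impact_time_ltS => //; apply: kfin; exact: ltnW.
  + by split => //; rewrite -x0 rlim_cadlag.
  + by move=> k kn; rewrite -jump ?kfin// rlim_cadlag// sigma_ge0.
  + split.
      move=> k t kn /andP[kt tk1]; apply: solve => //; first exact: ltnW.
      by rewrite kE.
    by apply: solve => //; rewrite -lee_fin -kE.
- by move=> k kn; apply: (angle_at_impact vc v0 cover thetaE); exact: kfin.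
- exact: (angle_before_impact alpha0 vc v0 cover thetaE nT).
- move=> k t kn /andP[kt tT] tk1; apply: thetaE; rewrite kE// lee_fin kt/=.
  move: kn; rewrite leq_eqVlt => /predU1P[kn|kn].
    by rewrite kn (le_lt_trans _ n2)// lee_fin.
  by rewrite kE// lte_fin; move: tk1; rewrite kn.
Qed.

Lemma deterministic_solution_impulsive_path b h (alpha r0 T : R) r theta n :
  0 < alpha -> n%:R * alpha <= T < n.+1%:R * alpha ->
  deterministic_solution b h alpha r0 r theta ->
  impulsive_path b h r0 r (cst 0) T n (fun k => k%:R * alpha).
Proof.
move=> alpha0 /andP[nT Tn] [rc _ r00 jump eqs].
have ka k : 0 <= k%:R * alpha by rewrite mulr_ge0// ltW.
have solve k t : k%:R * alpha <= t < k.+1%:R * alpha ->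
    solves_on b r (cst 0) (k%:R * alpha) t.
  move=> /andP[kt tk1] s /andP[ks st].
  have [|-> _] := eqs k s; first by rewrite ks (le_lt_trans st).
  by rewrite rlim_cadlag// subrr addr0.
split.
- by rewrite mul0r.
- by move=> k _; rewrite ltr_pM2r// ltr_nat.
- by split => //; rewrite -r00 rlim_cadlag.
- by move=> k _; rewrite -jump rlim_cadlag.
- split; first by move=> k t _; exact: solve.
  by apply: solve; rewrite nT.
Qed.

End ImpulsivePaths.

(** * Growth of impulsive paths *)

Section ImpulsiveEstimates.
Context {R : realType}.
Variables (b h : R -> R) (M L K : R).
Hypotheses (bc : continuous b) (bM : forall x, `|b x| <= M).
Hypotheses (L0 : 0 <= L) (bL : forall x y, `|b x - b y| <= L * `|x - y|).
Hypotheses (K1 : 1 <= K) (hK : forall x y, `|h x - h y| <= K * `|x - y|).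

Let M0 : 0 <= M.
Proof. exact: le_trans (normr_ge0 _) (bM 0). Qed.

Let K0 : 0 <= K. Proof. exact: le_trans ler01 K1. Qed.

Lemma cvg_left_norm_le (y : R -> R) (l s t B : R) : s < t ->
  y r @[r --> t^'-] --> l -> (forall r, s <= r < t -> `|y r| <= B) -> `|l| <= B.
Proof.
move=> st yl yB; rewrite leNgt; apply/negP => Bl.
have e0 : 0 < `|l| - B by rewrite subr_gt0.
have /cvgrPdist_lt/(_ _ e0) near_l := yl.
suff : \forall r \near t^'-, False by move/filter_ex => [].
near=> r.
have h1 : `|l - y r| < `|l| - B by near: r; exact: near_l.
have h2 : `|y r| <= B.
  apply: yB; apply/andP; split.
    by apply/ltW; near: r; exact: nbhs_left_gt.
  by near: r; exact: nbhs_left_lt.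
have := lerB_dist l (y r); lra.
Unshelve. all: by end_near. Qed.

Lemma piece_index (s : nat -> R) (n : nat) (t : R) : s 0%N <= t ->
  exists k, [/\ (k <= n)%N, s k <= t & (k < n)%N -> t < s k.+1].
Proof.
move=> st; elim: n => [|n [k [kn skt ts]]]; first by exists 0%N.
have [snt|tsn] := leP (s n.+1) t; first by exists n.+1; split; rewrite ?ltnn.
exists k; split => //; first exact: leqW.
rewrite ltnS leq_eqVlt => /predU1P[->//|]; exact: ts.
Qed.

Section Path.
Variables (r0 T : R) (x z : R -> R) (n : nat) (s : nat -> R).
Hypothesis path : impulsive_path b h r0 x z T n s.

Lemma impulsive_path_breakpoint_le j k : (j <= k)%N -> (k <= n)%N -> s j <= s k.
Proof.
case: path => _ s_incr _ _ _ jk; elim: k jk => [|k IH].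
  by rewrite leqn0 => /eqP->.
rewrite leq_eqVlt ltnS => /predU1P[->//|jk] kn.
by rewrite (le_trans (IH jk (ltnW kn)))// ltW// s_incr.
Qed.

Lemma impulsive_path_breakpoint_ge0 k : (k <= n)%N -> 0 <= s k.
Proof.
move=> kn; case: path => -[s0 _] _ _ _ _; rewrite -s0.
exact: impulsive_path_breakpoint_le.
Qed.

Lemma impulsive_path_breakpoint_leT k : (k <= n)%N -> s k <= T.
Proof.
move=> kn; case: path => -[_ snT] _ _ _ _; apply: le_trans snT.
exact: impulsive_path_breakpoint_le.
Qed.

Lemma impulsive_path_solves k t : (k <= n)%N -> s k <= t <= T ->
  ((k < n)%N -> t < s k.+1) -> solves_on b x z (s k) t.
Proof.
case: path => _ _ _ _ [sol solT]; rewrite leq_eqVlt => /predU1P[->|kn].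
  by move=> /andP[st tT] _ r /andP[sr rt]; apply: solT; rewrite sr (le_trans rt).
by move=> /andP[st tT] /(_ kn) ts; apply: sol => //; rewrite st.
Qed.

(** Each reset multiplies the radius by at most [K] up to an additive
    constant, and the motion between resets adds a bounded amount; the factor
    [2 * K] absorbs the additive terms. *)
Lemma impulsive_path_growth rho : 0 <= rho ->
  (forall q t, 0 <= q <= T -> 0 <= t <= T -> `|z t - z q| <= rho) ->
  forall t, 0 <= t <= T ->
  `|x t| <= (2 * K) ^+ n.+1 * (`|r0| + M * T + rho + `|h 0|).
Proof.
move=> rho0 zrho t /andP[t0 tT].
have T0 : 0 <= T by exact: le_trans t0 tT.
set Q := `|r0| + M * T + rho + `|h 0|.
have MT0 : 0 <= M * T by rewrite mulr_ge0.
have Q0 : 0 <= Q by rewrite !addr_ge0.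
have KK1 : 1 <= 2 * K by move: K1; lra.
case: (path) => -[s0 snT] s_incr [xc x0] jump _.
have piece k q : (k <= n)%N -> s k <= q <= T -> ((k < n)%N -> q < s k.+1) ->
    `|x q| <= `|x (s k)| + (M * T + rho).
  move=> kn /andP[skq qT] qs.
  have sk0 := impulsive_path_breakpoint_ge0 kn.
  have q0 := le_trans sk0 skq.
  have := @solution_growth R b M bc bM x z (s k) q rho xc sk0 skq.
  move=> /(_ (impulsive_path_solves kn _ qs) (zrho _ _ _ _)).
  rewrite skq qT q0 sk0 (le_trans skq qT) => /(_ isT isT isT) /le_trans; apply.
  by rewrite addrA lerD2r lerD2l ler_wpM2l// lerBlDr (le_trans qT)// lerDl.
have start k : (k <= n)%N -> `|x (s k)| <= (2 * K) ^+ k * Q.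
  elim: k => [_|k IH kn].
    rewrite s0 x0 expr0 mul1r /Q; have := normr_ge0 (h 0); lra.
  have skS := s_incr k kn.
  have sk0 := impulsive_path_breakpoint_ge0 (ltnW kn).
  have left_le : `|llim x (s k.+1)| <= `|x (s k)| + (M * T + rho).
    apply: (cvg_left_norm_le skS (llim_cvg xc (le_lt_trans sk0 skS))) => q /andP[skq qs].
    apply: piece => //; first exact: ltnW.
    by rewrite skq (le_trans (ltW qs))// impulsive_path_breakpoint_leT.
  have xk := IH (ltnW kn).
  rewrite jump//; have := hK (llim x (s k.+1)) 0; rewrite subr0 => h1.
  have h2 : K * `|llim x (s k.+1)| <= K * ((2 * K) ^+ k * Q + (M * T + rho)).
    by rewrite ler_wpM2l//; apply: (le_trans left_le); rewrite lerD2r.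
  have h3 : 1 <= (2 * K) ^+ k by rewrite exprn_ege1.
  have h4 : K * (M * T + rho) + `|h 0| <= K * Q.
    apply: (@le_trans _ _ (K * (M * T + rho) + K * `|h 0|)).
      by rewrite lerD2l ler_peMl.
    by rewrite -mulrDr ler_wpM2l// /Q; have := normr_ge0 r0; lra.
  have h5 : K * Q <= K * ((2 * K) ^+ k * Q).
    by rewrite ler_wpM2l// ler_peMl.
  have := ler_normD (h (llim x (s k.+1)) - h 0) (h 0); rewrite subrK.
  rewrite exprS -mulrA -mulrA; move: h1 h2 h4 h5; rewrite !mulrDr; lra.
have [k [kn skt ts]] := @piece_index s n t ltac:(by rewrite s0).
apply: (le_trans (piece k t kn _ ts)); first by rewrite skt.
have h3 : 1 <= (2 * K) ^+ k by rewrite exprn_ege1.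
apply: (@le_trans _ _ ((2 * K) ^+ k.+1 * Q)); last first.
  by rewrite ler_wpM2r// ler_weXn2l.
apply: (@le_trans _ _ ((2 * K) ^+ k * Q + (2 * K) ^+ k * Q)).
  apply: lerD; first exact: start.
  apply: (@le_trans _ _ Q); last by rewrite ler_peMl.
  by rewrite /Q; have := normr_ge0 r0; have := normr_ge0 (h 0); lra.
rewrite exprS -mulrA.
have : 0 <= (2 * K) ^+ k * Q by rewrite mulr_ge0// exprn_ge0// mulr_ge0.
move: (_ ^+ k * Q) => a a0.
have : 0 <= a * (K - 1) by rewrite mulr_ge0// subr_ge0.
lra.
Qed.

End Path.

End ImpulsiveEstimates.

(** * Comparison of two impulsive paths *)

Section CompareImpulsive.
Context {R : realType}.
Variables (b h : R -> R) (M L K : R).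
Hypotheses (bc : continuous b) (bM : forall x, `|b x| <= M).
Hypotheses (L0 : 0 <= L) (bL : forall x y, `|b x - b y| <= L * `|x - y|).
Hypotheses (K1 : 1 <= K) (hK : forall x y, `|h x - h y| <= K * `|x - y|).

(** Adds the terminal time [T] after the [n] impacts. *)
Definition breakpoints (s : nat -> R) (n : nat) (T : R) (k : nat) : R :=
  if (k <= n)%N then s k else T.

Lemma cvg_left_affine (y : R -> R) (l s t u m : R) : 0 < m ->
  y r @[r --> (u + m * (t - s))^'-] --> l ->
  y (u + m * (r - s)) @[r --> t^'-] --> l.
Proof.
move=> m0; apply: cvg_comp => Q HQ.
have lam_cont : {for t, continuous (fun r : R => u + m * (r - s))}.
  apply: cvgD; first exact: cvg_cst.
  by apply: cvgM; [exact: cvg_cst|apply: cvgB; [exact: cvg_id|exact: cvg_cst]].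
suff : \forall r \near t, r < t -> Q (u + m * (r - s)) by [].
have : \forall r \near t, u + m * (r - s) < u + m * (t - s) -> Q (u + m * (r - s)).
  exact: (lam_cont _ HQ).
by apply: filterS => r Hr rt; apply: Hr; rewrite ltrD2l ltr_pM2l// ltrD2r.
Qed.

Variables (r0 T : R) (x y z : R -> R) (n : nat) (s u : nat -> R).
Hypothesis xpath : impulsive_path b h r0 x z T n s.
Hypothesis ypath : impulsive_path b h r0 y (cst 0) T n u.
Variables (rho kappa : R).
Hypotheses (rho0 : 0 <= rho) (kappa0 : 0 <= kappa).
Hypothesis zrho : forall q t, 0 <= q <= T -> 0 <= t <= T -> `|z t - z q| <= rho.
Hypothesis zc : forall t, 0 < t -> {for t, continuous z}.
Local Notation m k := (slope (breakpoints s n T) (breakpoints u n T) k).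
Hypothesis snT : s n < T.
Hypothesis slope0 : forall k, (k <= n)%N -> 0 < m k.
Hypothesis slope1 : forall k, (k <= n)%N -> `|1 - m k| <= kappa.

Let M0 : 0 <= M.
Proof. exact: le_trans (normr_ge0 _) (bM 0). Qed.

Let K0 : 0 <= K. Proof. exact: le_trans ler01 K1. Qed.

Lemma breakpoints_lt k : (k <= n)%N ->
  breakpoints s n T k < breakpoints s n T k.+1.
Proof.
move=> kn; rewrite /breakpoints kn; case: ltnP => kn'.
  by case: xpath => _ + _ _ _; exact.
by have -> : k = n by apply/eqP; rewrite eqn_leq kn.
Qed.

Lemma slopeK k : (k <= n)%N ->
  u k + m k * (breakpoints s n T k.+1 - s k) = breakpoints u n T k.+1.
Proof.
move=> kn; have := breakpoints_lt kn.
have -> : breakpoints s n T k = s k by rewrite /breakpoints kn.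
have uk : breakpoints u n T k = u k by rewrite /breakpoints kn.
have sk : breakpoints s n T k = s k by rewrite /breakpoints kn.
by move=> ss; rewrite /slope sk uk divfK ?subrKC// subr_eq0 gt_eqF.
Qed.

(** The error on one piece is at most [A] times the error at its start plus
    the local error [c]; a reset multiplies it by [K]. Hence the error plus [c]
    grows by a factor of at most [2 * K * A] per impact. *)
Lemma impulsive_path_compare :
  let A := expR ((2 * L + 1) * T) in
  forall k t, (k <= n)%N -> s k <= t <= T -> ((k < n)%N -> t < s k.+1) ->
  `|x t - y (u k + m k * (t - s k))|
  <= A * (2 * K * A) ^+ n * (rho + (L * rho + kappa * M)).
Proof.
move=> A; set c := rho + (L * rho + kappa * M).
have c0 : 0 <= c by rewrite !addr_ge0 ?mulr_ge0.
have [[s0 _] s_incr [xc x0] xjump _] := xpath.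
have [[u0 _] u_incr [yc y0] yjump _] := ypath.
have T0 : 0 <= T by rewrite ltW// (le_lt_trans _ snT)// (impulsive_path_breakpoint_ge0 xpath).
have A1 : 1 <= A by rewrite -expR0 ler_expR mulr_ge0// addr_ge0// mulr_ge0.
have A0 : 0 <= A by exact: le_trans ler01 A1.
have KA1 : 1 <= 2 * K * A.
  have : 1 * 1 <= K * A by exact: ler_pM.
  lra.
have piece k t : (k <= n)%N -> s k <= t <= T -> ((k < n)%N -> t < s k.+1) ->
    `|x t - y (u k + m k * (t - s k))| <= A * (`|x (s k) - y (u k)| + c).
  move=> kn /andP[skt tT] ts.
  have sk0 := impulsive_path_breakpoint_ge0 xpath kn.
  have uk0 := impulsive_path_breakpoint_ge0 ypath kn.
  have mk0 := slope0 kn.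
  have lam_le q : q <= breakpoints s n T k.+1 ->
      u k + m k * (q - s k) <= breakpoints u n T k.+1.
    by move=> qs; rewrite -slopeK// lerD2l ler_pM2l// lerD2r.
  have lam_lt q : q < breakpoints s n T k.+1 ->
      u k + m k * (q - s k) < breakpoints u n T k.+1.
    by move=> qs; rewrite -slopeK// ltrD2l ltr_pM2l// ltrD2r.
  have tle : t <= breakpoints s n T k.+1.
    by rewrite /breakpoints; case: ifP => // /ts /ltW.
  have ysol : solves_on b y (cst 0) (u k) (u k + m k * (t - s k)).
    apply: (impulsive_path_solves ypath kn).
      rewrite lerDl mulr_ge0 ?(ltW mk0) ?subr_ge0//=.
      apply: (le_trans (lam_le _ tle)); rewrite /breakpoints; case: ifP => // k1n.
      exact: (impulsive_path_breakpoint_leT ypath).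
    move=> k1n; have := lam_lt t; rewrite /breakpoints k1n; apply; exact: ts.
  have xsol : solves_on b x z (s k) t.
    by apply: (impulsive_path_solves xpath kn) => //; rewrite skt.
  have tsT : t - s k <= T by rewrite lerBlDr (le_trans tT)// lerDl.
  have zc' : {in `]s k, t[, continuous z}.
    by move=> q; rewrite in_itv/= => /andP[sq _]; apply: zc; exact: le_lt_trans sq.
  have zrho' q : s k <= q <= t -> `|z q - z (s k)| <= rho.
    move=> /andP[sq qt]; apply: zrho.
      by rewrite sk0 (le_trans skt tT).
    by rewrite (le_trans sk0 sq) (le_trans qt tT).
  have := @compare_solutions R b M L bc bM L0 bL x y z (s k) t (u k) (m k) rho
    xc yc sk0 skt uk0 mk0 rho0 xsol ysol zc' zrho'.
  move=> /le_trans; apply.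
  have Ale : expR ((2 * L + 1) * (t - s k)) <= A.
    by rewrite ler_expR ler_wpM2l// addr_ge0// mulr_ge0.
  set e := `|x (s k) - y (u k)|.
  have e0 : 0 <= e by exact: normr_ge0.
  have d0 : 0 <= L * rho + `|1 - m k| * M by rewrite addr_ge0 ?mulr_ge0.
  have d1 : L * rho + `|1 - m k| * M <= L * rho + kappa * M.
    by rewrite lerD2l ler_wpM2r// slope1.
  apply: (@le_trans _ _ (A * rho + A * (e + (L * rho + kappa * M)))).
    apply: lerD; first by rewrite ler_peMl.
    apply: ler_pM; [exact: expR_ge0|by rewrite addr_ge0|exact: Ale|].
    by rewrite lerD2l.
  rewrite -mulrDr ler_wpM2l// /c; lra.
have start k : (k <= n)%N -> `|x (s k) - y (u k)| + c <= (2 * K * A) ^+ k * c.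
  elim: k => [_|k IH kn].
    by rewrite s0 u0 x0 y0 subrr normr0 add0r expr0 mul1r.
  have kn' := ltnW kn.
  have skS := s_incr k kn; have ukS := u_incr k kn.
  have sk0 := impulsive_path_breakpoint_ge0 xpath kn'.
  have uk0 := impulsive_path_breakpoint_ge0 ypath kn'.
  have lamS : u k + m k * (s k.+1 - s k) = u k.+1.
    by have := slopeK kn'; rewrite /breakpoints kn.
  have yl : y (u k + m k * (r - s k)) @[r --> (s k.+1)^'-] --> llim y (u k.+1).
    apply: cvg_left_affine; first exact: slope0.
    by rewrite lamS; apply: llim_cvg => //; exact: le_lt_trans ukS.
  have xl := llim_cvg xc (le_lt_trans sk0 skS).
  have left_le : `|llim x (s k.+1) - llim y (u k.+1)|
      <= A * (`|x (s k) - y (u k)| + c).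
    apply: (cvg_left_norm_le skS (cvgB xl yl)) => q /andP[skq qs].
    apply: piece => //.
    by rewrite skq (le_trans (ltW qs))// (impulsive_path_breakpoint_leT xpath).
  rewrite xjump// yjump//.
  have h1 := hK (llim x (s k.+1)) (llim y (u k.+1)).
  have h2 : K * `|llim x (s k.+1) - llim y (u k.+1)|
      <= K * (A * (`|x (s k) - y (u k)| + c)) by rewrite ler_wpM2l.
  have h3 : K * (A * (`|x (s k) - y (u k)| + c)) <= K * (A * ((2 * K * A) ^+ k * c)).
    by do 2 rewrite ler_wpM2l//; exact: IH.
  have h4 : c <= K * (A * ((2 * K * A) ^+ k * c)).
    rewrite !mulrA ler_peMl//.
    have : 1 * 1 <= K * A by exact: ler_pM.
    rewrite mulr1 => KA; have := ler_pM ler01 ler01 KA (exprn_ege1 k KA1).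
    by rewrite mulr1.
  apply: (le_trans (lerD (le_trans h1 (le_trans h2 h3)) h4)).
  rewrite exprS le_eqVlt; apply/orP; left; apply/eqP; ring.
move=> k t kn skt ts.
apply: (le_trans (piece k t kn skt ts)); rewrite -mulrA ler_wpM2l//.
apply: (le_trans (start k kn)); rewrite ler_wpM2r// ler_weXn2l//.
Qed.

End CompareImpulsive.

(** * Pathwise bounds on the Skorohod distance *)

Section Skorohod.
Context {R : realType}.

Lemma euclidean_norm_le (a c : R) : euclidean_norm (a, c) <= `|a| + `|c|.
Proof.
rewrite /euclidean_norm /= -[leRHS]ger0_norm ?addr_ge0// -sqrtr_sqr.
rewrite ler_wsqrtr// sqrrD !real_normK ?num_real// lerD2r lerDl.
by rewrite mulrn_wge0// mulr_ge0.
Qed.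

Lemma skorohod_le (T B : R) (lam : R -> R) (x1 x2 y1 y2 : R -> R) :
  time_change T lam -> (gamma_T T lam <= B%:E)%E ->
  (forall t, 0 <= t <= T -> `|x1 t - y1 (lam t)| + `|x2 t - y2 (lam t)| <= B) ->
  (skorohod T (fun t => (x1 t, x2 t)) (fun t => (y1 t, y2 t)) <= B%:E)%E.
Proof.
move=> lamT gB xyB; apply: (@le_trans _ _
  (maxe (gamma_T T lam) (ereal_sup [set (euclidean_norm
    ((x1 t, x2 t) - (y1 (lam t), y2 (lam t))))%:E | t in `[0, T]]))).
  by apply: ereal_inf_lbound; exists lam.
rewrite ge_max gB /=; apply: ge_ereal_sup => _ [t /= tT <-].
rewrite lee_fin; apply: le_trans (xyB t _); last by move: tT; rewrite in_itv.
exact: euclidean_norm_le.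
Qed.

Lemma skorohod_ge0 (T : R) (x y : R -> R * R) : 0 <= T ->
  (0 <= skorohod T x y)%E.
Proof.
move=> T0; apply: le_ereal_inf_tmp => _ [lam _ <-].
rewrite le_max; apply/orP; right.
apply: (@le_trans _ _ (euclidean_norm (x 0 - y (lam 0)))%:E).
  by rewrite lee_fin sqrtr_ge0.
by apply: ereal_sup_ubound; exists 0 => //=; rewrite in_itv/= lexx.
Qed.

Lemma time_change_id (T B : R) : 0 <= B ->
  time_change T (@id R) /\ (gamma_T T (@id R) <= B%:E)%E.
Proof.
move=> B0.
have gam : (gamma_T T (@id R) <= B%:E)%E.
  apply: ge_ereal_sup => _ [[s t] /= [_ st _] <-].
  by rewrite divff ?subr_eq0 ?gt_eqF// ln1 normr0 lee_fin.
split => //; split => //; last exact: le_lt_trans gam (ltry _).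
- by split => //; exact: surj_id.
- by apply: continuous_subspaceT => t; exact: cvg_id.
Qed.

End Skorohod.

Section Pathwise.
Context {R : realType}.
Variables (b h : R -> R) (M L K : R).
Hypotheses (bc : continuous b) (bM : forall x, `|b x| <= M).
Hypotheses (L0 : 0 <= L) (bL : forall x y, `|b x - b y| <= L * `|x - y|).
Hypotheses (K1 : 1 <= K) (hK : forall x y, `|h x - h y| <= K * `|x - y|).
Variables (alpha r0 T : R) (N : nat) (r theta : R -> R).
Hypothesis alpha0 : 0 < alpha.
Hypothesis hT : N%:R * alpha < T < N.+1%:R * alpha.
Hypothesis hdet : deterministic_solution b h alpha r0 r theta.

Let M0 : 0 <= M.
Proof. exact: le_trans (normr_ge0 _) (bM 0). Qed.

Let K0 : 0 <= K. Proof. exact: le_trans ler01 K1. Qed.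

Let T0 : 0 < T.
Proof. by move: hT => /andP[+ _]; apply: le_lt_trans; rewrite mulr_ge0// ltW. Qed.

(** The distance from [T] to the neighbouring multiples of [alpha], capped
    by [alpha]. As long as the impact times move by at most a quarter of
    it, both systems have [N] impacts on [[0, T]] and corresponding pieces have
    comparable lengths. *)
Definition impact_gap : R :=
  Num.min alpha (Num.min (T - N%:R * alpha) (N.+1%:R * alpha - T)).

Local Notation gap := impact_gap.

Lemma impact_gap_gt0 : 0 < gap.
Proof.
by rewrite /gap !lt_min alpha0 !subr_gt0; case/andP: hT => -> ->.
Qed.

Lemma slope_near_one (l a eta : R) : gap <= l -> `|a - l| <= 2 * eta ->
  4 * eta <= gap ->
  [/\ 0 < a, `|1 - l / a| <= 4 / gap * eta,
      expR (- (4 / gap * eta)) <= l / a & l / a <= expR (4 / gap * eta)].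
Proof.
move=> gl al eg; have g0 := impact_gap_gt0.
have l0 : 0 < l by exact: lt_le_trans gl.
have /andP[al1 al2] : - (2 * eta) <= a - l <= 2 * eta by rewrite -ler_norml.
have eta0 : 0 <= eta by lra.
have a0 : l / 2 <= a by lra.
have a00 : 0 < a by lra.
have kap0 : 0 <= 4 / gap * eta by rewrite mulr_ge0// divr_ge0// ltW.
have H1 : `|1 - l / a| <= 4 / gap * eta.
  have -> : 1 - l / a = (a - l) / a by rewrite mulrBl divff ?gt_eqF.
  rewrite normrM normfV (gtr0_norm a00) ler_pdivrMr//.
  apply: (le_trans al).
  have : gap / 2 <= a by lra.
  move=> ga; have : 4 / gap * eta * (gap / 2) <= 4 / gap * eta * a by rewrite ler_wpM2l.
  apply: le_trans; rewrite le_eqVlt; apply/orP; left; apply/eqP.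
  by field; rewrite gt_eqF.
split => //.
  rewrite expRN -[leRHS]invrK lef_pV2 ?posrE ?expR_gt0 ?invr_gt0 ?divr_gt0//.
  rewrite invf_div; apply: le_trans (expR_ge1Dx _).
  rewrite ler_pdivrMr// mulrDl mul1r.
  have : 4 / gap * eta * gap <= 4 / gap * eta * l by rewrite ler_wpM2l.
  have -> : 4 / gap * eta * gap = 4 * eta by field; rewrite gt_eqF.
  lra.
apply: le_trans (expR_ge1Dx _).
by move: H1; rewrite distrC ler_norml => /andP[_]; lra.
Qed.


Section Matched.
Variables (X Theta z v : R -> R) (e mv rho : R) (s : nat -> R).
Hypothesis path : impulsive_path b h r0 X z T N s.
Hypothesis sE : forall k, (k <= N)%N -> s k + e * v (s k) = k%:R * alpha.
Hypothesis ThetaE : forall k t, (k <= N)%N -> s k <= t <= T ->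
  (k < N)%N ==> (t < s k.+1) -> Theta t = (t - s k) + e * (v t - v (s k)).
Hypothesis e0 : 0 <= e.
Hypothesis vm : forall t, 0 <= t <= T -> `|v t| <= mv.
Hypothesis rho0 : 0 <= rho.
Hypothesis zrho : forall q t, 0 <= q <= T -> 0 <= t <= T -> `|z t - z q| <= rho.
Hypothesis zc : forall t, 0 < t -> {for t, continuous z}.
Hypothesis small : 4 * (e * mv) <= gap.

(** When both systems have [N] impacts, the piecewise linear time change
    that sends the impact times of one to those of the other has slopes within
    [kappa] of 1, and it makes the pieces of the two paths correspond. *)
Lemma skorohod_matched_impacts :
  forall A kappa : R, A = expR ((2 * L + 1) * T) -> kappa = 4 / gap * (e * mv) ->
  (skorohod T (fun t => (X t, Theta t)) (fun t => (r t, theta t)) <=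
   (kappa + A * (2 * K * A) ^+ N * (rho + (L * rho + kappa * M))
    + (kappa * T + 2 * (e * mv)))%:E)%E.
Proof.
move=> A kappa AE kappaE; set eta := e * mv.
have g0 := impact_gap_gt0.
have /andP[NT TN] := hT.
have mv0 : 0 <= mv by apply: le_trans (normr_ge0 _) (vm (t := 0) _); rewrite lexx ltW.
have eta0 : 0 <= eta by rewrite mulr_ge0.
have kappa0 : 0 <= kappa by rewrite kappaE mulr_ge0// divr_ge0// ltW.
pose u k : R := k%:R * alpha.
have ypath : impulsive_path b h r0 r (cst 0) T N u.
  by apply: (deterministic_solution_impulsive_path alpha0 _ hdet); rewrite ltW.
have s_in k : (k <= N)%N -> 0 <= s k <= T.
  move=> kN; rewrite (impulsive_path_breakpoint_ge0 path)//.
  by rewrite (impulsive_path_breakpoint_leT path).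
have evm t : 0 <= t <= T -> `|e * v t| <= eta.
  by move=> tT; rewrite normrM (ger0_norm e0) ler_wpM2l// vm.
have su k : (k <= N)%N -> `|s k - u k| <= eta.
  move=> kN; rewrite /u -sE//; have := evm _ (s_in k kN).
  by rewrite opprD addrA subrr sub0r normrN.
have ga : gap <= alpha by rewrite /gap ge_min lexx.
have gT : gap <= T - N%:R * alpha by rewrite /gap !ge_min lexx orbT.
have uS k : u k.+1 = u k + alpha by rewrite /u -[k.+1%:R]natr1 mulrDl mul1r.
have smallu k : (k <= N)%N -> gap <= breakpoints u N T k.+1 - breakpoints u N T k.
  move=> kN; rewrite /breakpoints kN; case: ltnP => kN'; first by rewrite uS addrC addKr.
  by have -> : k = N by apply/eqP; rewrite eqn_leq kN.
have near_s k : (k <= N)%N ->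
   `|(breakpoints s N T k.+1 - breakpoints s N T k) -
     (breakpoints u N T k.+1 - breakpoints u N T k)| <= 2 * eta.
  move=> kN; rewrite /breakpoints kN; have := su k kN; rewrite !ler_norml.
  case: ltnP => kN'; last by lra.
  by have := su _ kN'; rewrite !ler_norml; lra.
pose m k := slope (breakpoints s N T) (breakpoints u N T) k.
have slopeP k : (k <= N)%N -> [/\ 0 < breakpoints s N T k.+1 - breakpoints s N T k,
    `|1 - m k| <= kappa, expR (- kappa) <= m k & m k <= expR kappa].
  by move=> kN; rewrite kappaE; apply: slope_near_one; [exact: smallu|exact: near_s|exact: small].
have m0 k : (k <= N)%N -> 0 < m k.
  by move=> kN; have [_ _ + _] := slopeP k kN; apply: lt_le_trans; exact: expR_gt0.
have snT : s N < T.
  have [+ _ _ _] := slopeP N (leqnn N).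
  by rewrite /breakpoints leqnn ltnn subr_gt0.
have s0 : s 0%N = 0 by case: path => -[].
have [] := @piecewise_linear_time_change R (breakpoints s N T)
  (breakpoints u N T) N T kappa.
- by rewrite /breakpoints.
- by rewrite /breakpoints /u mul0r.
- by rewrite /breakpoints ltnn.
- by rewrite /breakpoints ltnn.
- by move=> k kN; rewrite -subr_gt0; have [] := slopeP k kN.
- by move=> k kN; have [_ _ -> ->] := slopeP k kN.
set lam := piecewise_linear _ _ _ => lamT lamg.
have A0 : 0 <= A by rewrite AE expR_ge0.
have X0 : 0 <= A * (2 * K * A) ^+ N * (rho + (L * rho + kappa * M)).
  apply: mulr_ge0; last by rewrite !addr_ge0 ?mulr_ge0.
  by rewrite mulr_ge0// exprn_ge0// mulr_ge0// mulr_ge0.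
have Y0 : 0 <= kappa * T + 2 * eta by rewrite addr_ge0 ?mulr_ge0// ltW.
apply: (skorohod_le lamT).
  by apply: (le_trans lamg); rewrite lee_fin -addrA lerDl addr_ge0.
move=> t /andP[t0 tT].
have [k [kN skt ts]] := @piece_index R s N t ltac:(by rewrite s0).
have tS : breakpoints s N T k <= t <= breakpoints s N T k.+1.
  by rewrite /breakpoints kN skt /=; case: ifP => // /ts /ltW.
have si j : (j <= N)%N -> breakpoints s N T j < breakpoints s N T j.+1.
  by move=> jN; rewrite -subr_gt0; have [] := slopeP j jN.
have lamE : lam t = u k + m k * (t - s k).
  rewrite /lam (@piecewise_linearE R _ _ N si k t kN tS) /breakpoints kN /=.
  by rewrite /u mul0r subr0.
have radial := @impulsive_path_compare R b h M L K bc bM L0 bL K1 hK r0 T X r z N s u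
  path ypath rho kappa rho0 kappa0 zrho zc snT m0 _ k t kN _ ts.
have angular : `|Theta t - theta (lam t)| <= kappa * T + 2 * eta.
  have lamS : u k + m k * (breakpoints s N T k.+1 - s k) = breakpoints u N T k.+1.
    exact: (@slopeK R b h r0 T X z N s u path snT k kN).
  have lam1 : u k <= lam t by rewrite lamE lerDl mulr_ge0 ?subr_ge0// ltW// m0.
  have lam2 : lam t < u k.+1.
    rewrite lamE; have [kN'|kN'] := ltnP k N.
      move: lamS; rewrite /breakpoints kN' => <-.
      by rewrite ltrD2l ltr_pM2l ?m0// ltrD2r ts.
    have kE : k = N by apply/eqP; rewrite eqn_leq kN.
    rewrite -lamE (@le_lt_trans _ _ T)//; last by rewrite kE.
    rewrite lamE; move: lamS; rewrite /breakpoints kE ltnn => lamS'; rewrite -[leRHS]lamS'.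
    by rewrite lerD2l ler_pM2l ?m0// lerD2r.
  have [_ _ _ _ /(_ k (lam t)) detE] := hdet.
  have [|_ ->] := detE; first by rewrite lam1.
  rewrite (ThetaE (k := k))//; [|by rewrite skt|by apply/implyP].
  have -> : t - s k + e * (v t - v (s k)) - (lam t - k%:R * alpha) =
     (1 - m k) * (t - s k) + (e * v t - e * v (s k)).
    by rewrite lamE /u; ring.
  apply: (le_trans (ler_normD _ _)); apply: lerD.
    have [_ mk _ _] := slopeP k kN.
    rewrite normrM; apply: ler_pM => //.
    have /andP[sk0 _] := s_in k kN.
    by rewrite ger0_norm ?subr_ge0// lerBlDr (le_trans tT)// lerDl.
  apply: (le_trans (ler_normB _ _)); rewrite mulr_natl mulr2n lerD//.
    by apply: evm; rewrite t0.
  exact/evm/s_in.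
rewrite -addrA -[leLHS]add0r lerD// lerD//.
rewrite lamE AE; apply: radial.
  by move=> j jN; have [] := slopeP j jN.
by rewrite skt.
Qed.

End Matched.

Lemma deterministic_angle_le t : 0 <= t <= T -> `|theta t| <= T.
Proof.
move=> /andP[t0 tT]; have /andP[NT TN] := hT.
have [|k [kN kt tk]] := @piece_index R (fun k => k%:R * alpha) N t; first by rewrite mul0r.
have [_ _ _ _ /(_ k t)] := hdet => -[|_ ->].
  rewrite kt /=; move: kN; rewrite leq_eqVlt => /predU1P[->|/tk//].
  exact: le_lt_trans TN.
rewrite ger0_norm ?subr_ge0// lerBlDr (le_trans tT)// lerDl.
by rewrite mulr_ge0// ltW.
Qed.

(** Crude bound for the case where the numbers of impacts may differ: the
    identity time change, and the growth of each of the two paths. *)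
Lemma skorohod_any_impacts (X Theta z v : R -> R) (e mv rho : R) (s : nat -> R) n :
  impulsive_path b h r0 X z T n s ->
  (forall k t, (k <= n)%N -> s k <= t <= T ->
     (k < n)%N ==> (t < s k.+1) -> Theta t = (t - s k) + e * (v t - v (s k))) ->
  0 <= e -> (forall t, 0 <= t <= T -> `|v t| <= mv) -> 0 <= rho ->
  (forall q t, 0 <= q <= T -> 0 <= t <= T -> `|z t - z q| <= rho) ->
  (skorohod T (fun t => (X t, Theta t)) (fun t => (r t, theta t)) <=
   ((2 * K) ^+ n.+1 * (`|r0| + M * T + rho + `|h 0|)
    + (2 * K) ^+ N.+1 * (`|r0| + M * T + `|h 0|) + (T + 2 * (e * mv) + T))%:E)%E.
Proof.
move=> path ThetaE e0 vm rho0 zrho; set B1 := _ ^+ n.+1 * _; set B2 := _ ^+ N.+1 * _.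
have /andP[NT TN] := hT.
have mv0 : 0 <= mv by apply: le_trans (normr_ge0 _) (vm 0 _); rewrite lexx ltW.
have ypath : impulsive_path b h r0 r (cst 0) T N (fun k => k%:R * alpha).
  by apply: (deterministic_solution_impulsive_path alpha0 _ hdet); rewrite ltW.
have XB t : 0 <= t <= T -> `|X t| <= B1.
  exact: (@impulsive_path_growth R b h M K bc bM K1 hK r0 T X z n s path rho rho0 zrho).
have rB t : 0 <= t <= T -> `|r t| <= B2.
  move=> tT; have := @impulsive_path_growth R b h M K bc bM K1 hK r0 T r (cst 0) N _
    ypath 0 (lexx 0) _ t tT; rewrite addr0; apply.
  by move=> q t' _ _; rewrite subrr normr0.
have ThetaB t : 0 <= t <= T -> `|Theta t| <= T + 2 * (e * mv).
  move=> /andP[t0 tT].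
  have s0 : s 0%N = 0 by case: path => -[].
  have [k [kn skt ts]] := @piece_index R s n t ltac:(by rewrite s0).
  have sk0 := impulsive_path_breakpoint_ge0 path kn.
  rewrite (ThetaE k)//; [|by rewrite skt|by apply/implyP].
  apply: (le_trans (ler_normD _ _)); apply: lerD.
    by rewrite ger0_norm ?subr_ge0// lerBlDr (le_trans tT)// lerDl.
  rewrite normrM (ger0_norm e0) mulrCA ler_wpM2l//.
  apply: (le_trans (ler_normB _ _)); rewrite mulr_natl mulr2n lerD// vm ?t0//.
  by rewrite sk0 (impulsive_path_breakpoint_leT path).
have Bpos : 0 <= B1 + B2 + (T + 2 * (e * mv) + T).
  have z0 : 0 <= (0 : R) <= T by rewrite lexx ltW.
  have h1 := le_trans (normr_ge0 _) (XB 0 z0); have h2 := le_trans (normr_ge0 _) (rB 0 z0).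
  have h3 := le_trans (normr_ge0 _) (ThetaB 0 z0); exact: addr_ge0 (addr_ge0 h1 h2) (addr_ge0 h3 (ltW T0)).
have [idT idg] := time_change_id T Bpos.
apply: (skorohod_le idT idg) => t tT; apply: lerD.
  by apply: (le_trans (ler_normB _ _)); rewrite lerD ?XB ?rB.
apply: (le_trans (ler_normB _ _)); rewrite lerD ?ThetaB//.
exact: deterministic_angle_le.
Qed.

Lemma le_expR_self (x : R) : x <= expR x.
Proof. by apply: le_trans (expR_ge1Dx x); rewrite lerDr. Qed.

(** If [eps `^ p * mv] is small, the impacts of the two systems match. If it
    is not, the number [n] of perturbed impacts is only bounded by
    [(T + mv) / alpha], so the radius may be exponentially large in [mv]; but
    then [1 <= 4 / impact_gap * eps * mv], which restores the factor [eps]. *)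
Lemma pathwise_skorohod_bound : exists C c : R, [/\ 0 < C, 0 < c &
  forall (p eps : R) (w v X Theta : R -> R) (mw mv : R),
  1 < p -> 0 < eps < 1 ->
  {within `[0, +oo[, continuous w} -> {within `[0, +oo[, continuous v} -> v 0 = 0 ->
  (forall t, 0 <= t <= T -> `|w t| <= mw) -> (forall t, 0 <= t <= T -> `|v t| <= mv) ->
  perturbed_solution b h alpha r0 p eps w v X Theta ->
  (skorohod T (fun t => (X t, Theta t)) (fun t => (r t, theta t)) <=
   (C * eps * expR (c * (mw + mv)))%:E)%E].
Proof.
pose A := expR ((2 * L + 1) * T).
pose D := A * (2 * K * A) ^+ N.
pose G := 2 * K.
pose q := `|r0| + M * T + `|h 0|.
pose C1 := 4 / gap + D * ((1 + L) * 2 + 4 / gap * M) + 4 / gap * T + 2.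
pose E0 := expR (ln G * (T / alpha + 1)).
pose C3 := E0 * (q + 2) + G ^+ N.+1 * q + (T + T) + 2.
pose c1 := ln G / alpha.
have g0 := impact_gap_gt0.
have G1 : 1 <= G by rewrite /G; move: K1; lra.
have Gp : 0 < G by exact: lt_le_trans ltr01 G1.
have c10 : 0 <= c1 by rewrite divr_ge0 ?ln_ge0// ltW.
have A0 : 0 <= A by exact: expR_ge0.
have D0 : 0 <= D by rewrite mulr_ge0// exprn_ge0// mulr_ge0// mulr_ge0.
have q0 : 0 <= q by rewrite !addr_ge0// mulr_ge0// ltW.
have k0 : 0 < 4 / gap by rewrite divr_gt0.
have T0' := ltW T0.
have E00 : 0 <= E0 by exact: expR_ge0.
have C10 : 0 < C1.
  apply: ltr_wpDl => //; apply: addr_ge0; last exact: mulr_ge0 (ltW k0) T0'.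
  apply: addr_ge0; first exact: ltW.
  apply: mulr_ge0 => //; apply: addr_ge0; last exact: mulr_ge0 (ltW k0) M0.
  by apply: mulr_ge0 => //; exact: addr_ge0.
have Gq0 : 0 <= G ^+ N.+1 * q + (T + T).
  apply: addr_ge0; last exact: addr_ge0.
  by apply: mulr_ge0 => //; apply: exprn_ge0; exact: ltW.
have Eq0 : 0 <= E0 * (q + 2) by apply: mulr_ge0 => //; exact: addr_ge0.
have C30 : 0 < C3.
  by rewrite /C3 -(addrA (E0 * _)); apply: ltr_wpDl => //; exact: addr_ge0.
exists (C1 + C3 * (4 / gap)), (c1 + 2); split; first by rewrite addr_gt0// mulr_gt0.
  by rewrite ltr_wpDl.
move=> p eps w v X Theta mw mv p1 /andP[eps0 eps1] wc vc v0 wm vm sol.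
have z0 : 0 <= (0 : R) <= T by rewrite lexx.
have mw0 : 0 <= mw := le_trans (normr_ge0 _) (wm 0 z0).
have mv0 : 0 <= mv := le_trans (normr_ge0 _) (vm 0 z0).
have [n [s [path sE Tn ThetaE]]] :=
  perturbed_solution_impulsive_path alpha0 T0' vc v0 sol.
set e := eps `^ p in sE Tn ThetaE.
have e0 : 0 <= e by exact: powR_ge0.
have ee : e <= eps.
  by apply: ge1r_powR; rewrite ?eps0 ?(ltW eps1)// ltW.
have evm t : 0 <= t <= T -> `|e * v t| <= e * mv.
  by move=> tT; rewrite normrM (ger0_norm e0) ler_wpM2l// vm.
pose rho := 2 * (eps * mw).
have rho0 : 0 <= rho by rewrite mulr_ge0// mulr_ge0// ltW.
have zrho q' t : 0 <= q' <= T -> 0 <= t <= T -> `|eps * w t - eps * w q'| <= rho.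
  move=> qT tT; rewrite -mulrBr normrM (gtr0_norm eps0) /rho mulrCA ler_pM2l//.
  by apply: (le_trans (ler_normB _ _)); rewrite mulr_natl mulr2n lerD// wm.
have evle : e * mv <= eps * mv by rewrite ler_wpM2r.
have ev0 : 0 <= e * mv by rewrite mulr_ge0.
set S := mw + mv.
have S0 : 0 <= S by rewrite addr_ge0.
have mvS : mv <= S by rewrite lerDr.
have mwS : mw <= S by rewrite lerDl.
have /andP[NT TN] := hT.
have [small|big] := leP (4 * (e * mv)) gap.
  have nN : n = N.
    have ga1 : gap <= T - N%:R * alpha by rewrite /gap !ge_min lexx orbT.
    have ga2 : gap <= N.+1%:R * alpha - T by rewrite /gap !ge_min lexx !orbT.
    have Tin : 0 <= T <= T by rewrite T0' lexx.
    have := evm T Tin; rewrite ler_norml => /andP[ev1 ev2].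
    have sn0 := impulsive_path_breakpoint_ge0 path (leqnn n).
    have snT := impulsive_path_breakpoint_leT path (leqnn n).
    have := evm (s n); rewrite sn0 snT => /(_ isT); rewrite ler_norml => /andP[ev3 ev4].
    have := sE n (leqnn n) => snE.
    have lt_of (i j : nat) : i%:R * alpha < j%:R * alpha -> (i < j)%N.
      by rewrite ltr_pM2r// ltr_nat.
    by apply/eqP; rewrite eqn_leq; apply/andP; split; rewrite -ltnS; apply: lt_of; lra.
  rewrite nN in path sE ThetaE.
  have zc t : 0 < t -> {for t, continuous (fun t => eps * w t)}.
    by move=> t0; apply: cvgM; [exact: cvg_cst|exact: within_continuous_at].
  have := skorohod_matched_impacts path sE ThetaE e0 vm rho0 zrho zc small
    (erefl A) (erefl _).
  move/le_trans; apply; rewrite lee_fin -/D.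
  apply: (@le_trans _ _ (C1 * eps * S)).
    have f1 : 4 / gap * (e * mv) <= 4 / gap * (eps * S).
      by rewrite ler_pM2l// (le_trans evle)// ler_pM2l.
    have f2 : eps * mw <= eps * S by rewrite ler_pM2l.
    have f3 : e * mv <= eps * S by rewrite (le_trans evle)// ler_pM2l.
    have f4 : D * (rho + (L * rho + 4 / gap * (e * mv) * M)) <=
       D * ((1 + L) * 2 * (eps * S) + 4 / gap * (eps * S) * M).
      rewrite ler_wpM2l// addrA lerD//; last by rewrite ler_wpM2r.
      have -> : rho + L * rho = (1 + L) * 2 * (eps * mw) by rewrite /rho; ring.
      by rewrite ler_wpM2l// mulr_ge0// addr_ge0.
    have f5 : 4 / gap * (e * mv) * T <= 4 / gap * (eps * S) * T by rewrite ler_wpM2r.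
    have -> : C1 * eps * S = 4 / gap * (eps * S) +
      D * ((1 + L) * 2 * (eps * S) + 4 / gap * (eps * S) * M) +
      (4 / gap * (eps * S) * T + 2 * (eps * S)) by rewrite /C1; ring.
    by rewrite lerD// lerD// ler_pM2l.
  rewrite ler_pM ?mulr_ge0//; try exact: ltW.
    by rewrite ler_pM2r// lerDl mulr_ge0// ltW.
  apply: (le_trans (le_expR_self S)); rewrite ler_expR.
  by rewrite ler_peMl//; move: c10; lra.
have := skorohod_any_impacts path ThetaE e0 vm rho0 zrho.
move/le_trans; apply; rewrite lee_fin -/G.
have E1 : 1 <= expR S by rewrite -expR0 ler_expR.
have Ec1 : 1 <= expR ((c1 + 1) * S) by rewrite -expR0 ler_expR mulr_ge0// addr_ge0.
have ev1 : e * mv <= mv by rewrite ler_piMl// (le_trans ee)// ltW.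
have nbound : n.+1%:R <= T / alpha + 1 + mv / alpha.
  have sn0 := impulsive_path_breakpoint_ge0 path (leqnn n).
  have snT := impulsive_path_breakpoint_leT path (leqnn n).
  have := evm (s n); rewrite sn0 snT => /(_ isT); rewrite ler_norml => /andP[ev3 ev4].
  have na : n%:R * alpha <= T + mv by rewrite -sE//; lra.
  rewrite -[n.+1%:R]natr1 addrAC lerD2r -mulrDl ler_pdivlMr//.
have Gn : G ^+ n.+1 <= E0 * expR (c1 * mv).
  have -> : G ^+ n.+1 = expR (ln G * n.+1%:R) by rewrite mulrC expRM_natl lnK.
  rewrite -expRD ler_expR.
  apply: (le_trans (ler_wpM2l (ln_ge0 G1) nbound)).
  by rewrite mulrDr lerD2l /c1 mulrA mulrAC.
have Qw : `|r0| + M * T + rho + `|h 0| <= (q + 2) * expR mw.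
  have h1 : 1 <= expR mw by rewrite -expR0 ler_expR.
  have h2 := le_expR_self mw.
  have h3 : eps * mw <= mw by rewrite ler_piMl// ltW.
  have h4 : q <= q * expR mw by rewrite ler_peMr.
  rewrite mulrDl; move: h4; rewrite {1}/q /rho; lra.
have Bbound : G ^+ n.+1 * (`|r0| + M * T + rho + `|h 0|) + G ^+ N.+1 * q +
   (T + 2 * (e * mv) + T) <= C3 * expR ((c1 + 1) * S).
  have -> : C3 * expR ((c1 + 1) * S) = E0 * (q + 2) * expR ((c1 + 1) * S)
     + (G ^+ N.+1 * q + (T + T)) * expR ((c1 + 1) * S) + 2 * expR ((c1 + 1) * S).
    by rewrite /C3; ring.
  have f1 : G ^+ n.+1 * (`|r0| + M * T + rho + `|h 0|)
      <= E0 * (q + 2) * expR ((c1 + 1) * S).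
    apply: (@le_trans _ _ ((E0 * expR (c1 * mv)) * ((q + 2) * expR mw))).
      apply: ler_pM => //; first by rewrite exprn_ge0// ltW.
      by rewrite !addr_ge0// mulr_ge0.
    rewrite mulrACA -expRD; apply: (ler_wpM2l Eq0).
    rewrite ler_expR mulrDl mul1r lerD// ler_wpM2l//.
  have f2 : G ^+ N.+1 * q + (T + T) <= (G ^+ N.+1 * q + (T + T)) * expR ((c1 + 1) * S).
    by rewrite ler_peMr// !addr_ge0// mulr_ge0// exprn_ge0// ltW.
  have f3 : e * mv <= expR ((c1 + 1) * S).
    apply: (le_trans ev1); apply: (le_trans mvS); apply: (le_trans (le_expR_self S)).
    by rewrite ler_expR ler_peMl// lerDr.
  lra.
apply: (le_trans Bbound).
(* Here [4 * (e * mv)] exceeds the gap. *)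
have one : 1 <= 4 / gap * eps * expR S.
  apply: (@le_trans _ _ (4 / gap * (eps * mv))).
    rewrite mulrAC ler_pdivlMr// mul1r; apply: ltW; apply: (lt_le_trans big).
    by rewrite ler_pM2l.
  rewrite -[leRHS]mulrA ler_pM2l// ler_pM2l//.
  by apply: (le_trans mvS); exact: le_expR_self.
apply: (@le_trans _ _ (C3 * expR ((c1 + 1) * S) * (4 / gap * eps * expR S))).
  by rewrite ler_peMr// mulr_ge0 ?expR_ge0// ltW.
have -> : expR ((c1 + 2) * S) = expR ((c1 + 1) * S) * expR S.
  by rewrite -expRD; congr expR; ring.
have : 0 <= expR ((c1 + 1) * S) * expR S by rewrite mulr_ge0 ?expR_ge0.
move: (expR ((c1 + 1) * S)) (expR S) => F1 F2 F0.
have -> : C3 * F1 * (4 / gap * eps * F2) = C3 * (4 / gap) * eps * (F1 * F2) by ring.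
apply: ler_wpM2r => //; rewrite ler_pM2r// lerDr; exact: ltW.
Qed.

End Pathwise.

(** * Expected Skorohod distance *)

Section Coefficients.
Context {R : realType}.

Lemma bounded_funP (f : R -> R) : bounded_fun f -> exists2 M, 0 <= M & forall x, `|f x| <= M.
Proof.
move=> [M [_ fM]]; exists (`|M| + 1); first by rewrite addr_ge0.
by move=> x; apply: fM => //; rewrite ltr_pwDr// ler_norm.
Qed.

Lemma bounded_derive_lipschitz (f : R -> R) (L : R) :
  (forall x, derivable f x 1) -> (forall x, `|f^`()%classic x| <= L) ->
  forall x y, `|f x - f y| <= L * `|x - y|.
Proof.
move=> df dL x y; wlog xy : x y / x < y => [H|].
  have [/H//|/H|->] := ltgtP x y; last by rewrite !subrr normr0 mulr0.
  by rewrite distrC [`|x - y|]distrC.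
have df' (z : R) : is_derive z 1 f (f^`()%classic z) by rewrite derive1E; exact: DeriveDef.
have [|z _ fE] := @MVT R f (f^`()%classic) x y xy (fun z _ => df' z).
  apply: continuous_subspaceT => z.
  by apply: differentiable_continuous; apply/derivable1_diffP.
by rewrite distrC fE normrM [`|x - y|]distrC ler_wpM2r.
Qed.

Lemma drift_regular (b : R -> R) : drift b -> exists M L : R,
  [/\ continuous b, (forall x, `|b x| <= M), 0 <= L
    & forall x y, `|b x - b y| <= L * `|x - y|].
Proof.
move=> [bs /bounded_funP[M _ bM] /bounded_funP[L L0 bL] _].
exists M, L; split => //.
- by move=> x; apply: differentiable_continuous; apply/derivable1_diffP; exact: (bs 0%N).
- exact: (bounded_derive_lipschitz (bs 0%N)).
Qed.

Lemma lipschitz_ge1 (h : R -> R) (k : R) : k.-lipschitz h -> exists2 K : R, 1 <= K &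
  forall x y, `|h x - h y| <= K * `|x - y|.
Proof.
move=> hk; exists (Num.max 1 k); first by rewrite le_max lexx.
move=> x y; apply: (le_trans (hk (x, y) (conj I I))).
by rewrite ler_wpM2r// le_max lexx orbT.
Qed.

Lemma le_expe (x : \bar R) (a : R) n : (0 <= x)%E -> (x <= a%:E)%E ->
  (x ^+ n <= (a ^+ n)%:E)%E.
Proof.
move=> x0 xa; elim: n => [|n IH]; first by rewrite expe0 expr0.
by rewrite expeS exprS EFinM lee_pmul// expe_ge0.
Qed.

Lemma expR_mean_le (a c : R) : expR ((a + c) / 2) <= expR a + expR c.
Proof.
wlog ac : a c / a <= c => [H|].
  by have [/H//|/ltW/H] := leP a c; rewrite addrC [leRHS]addrC.
by rewrite ler_wpDl ?expR_ge0// ler_expR ler_pdivrMr// mulr_natr mulr2n lerD2r.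
Qed.

End Coefficients.

Theorem theorem2p4 (R : realType) (d : measure_display)
  (Omega : measurableType d) (P : probability Omega R)
  (W B : R -> {RV P >-> R})
  (hW : brownian_motion W) (hB : brownian_motion B)
  (hWB : independent_processes W B)
  (b : R -> R) (hb : drift b)
  (h : R -> R) (hh : resetting h)
  (hext : exists k : R, k.-lipschitz h)
  (p : R) (hp : 1 < p)
  (beta : nat) (hbeta : beta = 1%N \/ beta = 2%N)
  (alpha : R) (halpha : 0 < alpha < 2 * pi)
  (r0 : R) (hr0 : 0 < r0)
  (N : nat) (T : R) (hT : N%:R * alpha < T < N.+1%:R * alpha)
  (r theta : R -> R) (hx : deterministic_solution b h alpha r0 r theta)
  (Reps Thetaeps : R -> R -> {RV P >-> R})
  (hX : forall eps, 0 < eps < 1 ->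
     {ae P, forall omega, perturbed_solution b h alpha r0 p eps
        (W ^~ omega) (B ^~ omega)
        (Reps eps ^~ omega) (Thetaeps eps ^~ omega)}) :
  exists2 C : R, 0 < C & exists2 eps0 : R, 0 < eps0 &
    forall eps : R, 0 < eps < 1 -> eps < eps0 ->
      (\int[P]_omega (skorohod T
           (fun t => (Reps eps t omega, Thetaeps eps t omega))
           (fun t => (r t, theta t))) ^+ beta
       <= (C * eps ^+ beta)%:E)%E.
Proof.
have [M [L [bc bM L0 bL]]] := drift_regular hb.
have [k /lipschitz_ge1[K K1 hK]] := hext.
have alpha0 : 0 < alpha by case/andP: halpha.
have T0 : 0 < T.
  by have /andP[+ _] := hT; apply: le_lt_trans; rewrite mulr_ge0// ltW.
have beta0 : 0 < beta%:R :> R by case: hbeta => ->; rewrite ltr0n.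
have [C [c [C0 c0 path]]] := pathwise_skorohod_bound bc bM L0 bL K1 hK alpha0 hT hx.
(* The factor 2 leaves room for the arithmetic mean of the two logarithms in
   [expR_mean_le], so that no joint moment of the two majorants is needed. *)
pose c' := 2 * beta%:R * c.
have c'0 : 0 < c' by rewrite !mulr_gt0.
have [GW [IW [mGW GW0 IW0 IWE maxW]]] := brownian_maximum_exp_moment hW c'0 T0.
have [GB [IB [mGB GB0 IB0 IBE maxB]]] := brownian_maximum_exp_moment hB c'0 T0.
exists (C ^+ beta * (IW + IB) + 1).
  by rewrite ltr_wpDl// mulr_ge0 ?exprn_ge0 ?addr_ge0// ltW.
exists 1 => // eps eps01 _; have /andP[eps0 eps1] := eps01.
have Ce0 : 0 <= (C * eps) ^+ beta by rewrite exprn_ge0// mulr_ge0// ltW.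
apply: (@le_trans _ _ (\int[P]_omega
    (((C * eps) ^+ beta)%:E * (GW omega + GB omega)))%E); last first.
  rewrite ge0_integralZl//; last 2 first.
  - exact: emeasurable_funD.
  - by move=> omega _; rewrite adde_ge0.
  rewrite ge0_integralD// IWE IBE -EFinD -EFinM lee_fin exprMn.
  rewrite mulrAC ler_wpM2r ?exprn_ge0 ?ltW//; lra.
apply: ge0_ae_le_integral_outer.
- by move=> omega; rewrite expe_ge0// skorohod_ge0// ltW.
- by move=> omega; rewrite mule_ge0// adde_ge0.
- by apply: emeasurable_funM; [exact: measurable_cst|exact: emeasurable_funD].
have [_ _ _ Wc] := hW; have [B0 _ _ Bc] := hB.
have sol := hX eps eps01.
apply: filterS2 (filterI maxW maxB) (filterI (filterI Wc Bc) (filterI B0 sol)).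
move=> omega [{}maxW {}maxB] [[{}Wc {}Bc] [{}B0 {}sol]].
have z0 : 0 <= (0 : R) <= T by rewrite lexx ltW.
have := skorohod_ge0 (fun t => (Reps eps t omega, Thetaeps eps t omega))
  (fun t => (r t, theta t)) (ltW T0).
set sk := skorohod _ _ _ => sk0.
have fin_case (gW gB : R) : GW omega = gW%:E -> GB omega = gB%:E ->
    (sk <= (C * eps * expR ((ln gW + ln gB) / 2 / beta%:R))%:E)%E /\ 0 < gW /\ 0 < gB.
  move=> GWE GBE.
  have gW0 : 0 < gW.
    have := maxW 0 z0; rewrite GWE lee_fin; apply: lt_le_trans; exact: expR_gt0.
  have gB0 : 0 < gB.
    have := maxB 0 z0; rewrite GBE lee_fin; apply: lt_le_trans; exact: expR_gt0.
  split=> //.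
  have -> : (ln gW + ln gB) / 2 / beta%:R = c * (ln gW / c' + ln gB / c').
    by rewrite /c'; field; rewrite !gt_eqF.
  apply: (path p eps (W ^~ omega) (B ^~ omega)) => //.
  - move=> t tT; rewrite ler_pdivlMr// mulrC -ler_expR lnK//.
    by rewrite -lee_fin -GWE; exact: maxW.
  - move=> t tT; rewrite ler_pdivlMr// mulrC -ler_expR lnK//.
    by rewrite -lee_fin -GBE; exact: maxB.
have Cgt0 : 0 < (C * eps) ^+ beta by rewrite exprn_gt0// mulr_gt0.
move: fin_case (GW0 omega) (GB0 omega).
case: (GW omega) => [gW| |//]; case: (GB omega) => [gB| |//] fin_case _ _.
- have [skle [gW0 gB0]] := fin_case gW gB erefl erefl.
  apply: (le_trans (le_expe beta sk0 skle)); rewrite -EFinD -EFinM lee_fin.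
  rewrite exprMn ler_pM2l// -expRM_natl.
  have -> : beta%:R * ((ln gW + ln gB) / 2 / beta%:R) = (ln gW + ln gB) / 2.
    by field; rewrite gt_eqF.
  by apply: (le_trans (expR_mean_le _ _)); rewrite !lnK.
(* If one of the majorants is infinite, so is the bound. *)
- by rewrite addey// gt0_muley ?lte_fin// leey.
- by rewrite addye// gt0_muley ?lte_fin// leey.
- by rewrite addye// gt0_muley ?lte_fin// leey.
Qed.
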